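(* Let $k_n,\dots,k_1\in\{+,-\}$, let $k$ be the number of indices $i$ with $k_i=-$, and let $D=d(k_n,\dots,k_1)$ be the $n$-diagram associated with the label $(k_n,\dots,k_1)$ by the construction described in the context. Then the vector $$D\cdot\big(\underbrace{v_-\otimes\cdots\otimes v_-}_{k}\otimes\underbrace{v_+\otimes\cdots\otimes v_+}_{n-k}\big)\in(\mathbb C^2)^{\otimes n}$$ equals the vector $v_{k_n}\heartsuit\cdots\heartsuit v_{k_1}$ obtained by decomposing the word $(k_n,\dots,k_1)$ with the rules (i)-(iii) given in the context.
   Context: Let $q\in\mathbb C$ be nonzero and not a root of unity. Temperley-Lieb algebra. An $n$-diagram consists of two parallel horizontal lines (bottom and top) with $n$ vertices each, numbered from left to right, the $2n$ vertices being joined in pairs by pairwise non-crossing edges (''links'') drawn between the lines, up to homotopy. $\mathrm{TL}_n$ is the $\mathbb C$-algebra with basis the $n$-diagrams; the product $D'D$ is obtained by stacking $D'$ on top of $D$ and replacing each closed loop by the factor $-q-q^{-1}$. It is generated by $e_1,\dots,e_{n-1}$, where $e_i$ joins vertices $i,i+1$ on the bottom line, joins vertices $i,i+1$ on the top line, and has vertical links elsewhere. Action. $\mathbb C^2$ has basis $v_+,v_-$. Let $\epsilon:\mathbb C^2\otimes\mathbb C^2\to\mathbb C$, $v_+\otimes v_+\mapsto 0$, $v_+\otimes v_-\mapsto -q$, $v_-\otimes v_+\mapsto 1$, $v_-\otimes v_-\mapsto 0$, and $\delta:\mathbb C\to\mathbb C^2\otimes\mathbb C^2$, $1\mapsto v_+\otimes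 v_- -q^{-1}v_-\otimes v_+$. $\mathrm{TL}_n$ acts on $(\mathbb C^2)^{\otimes n}$ by $e_i\mapsto \mathrm{id}^{\otimes(i-1)}\otimes(\delta\circ\epsilon)\otimes\mathrm{id}^{\otimes(n-i-1)}$. Construction of $d(k_n,\dots,k_1)$. Label the top vertices from left to right by $v_{k_n},\dots,v_{k_1}$. Process the indices $i$ with $k_i=+$ in increasing order of $i$: if there is a not yet linked $v_{k_j}$ with $j<i$ and $k_j=-$, take the greatest such $j$ and link $v_{k_i}$ with $v_{k_j}$; otherwise do nothing. Let $p$ be the number of links drawn on the top line. On the bottom line (vertices counted from the left) link vertex $k-i$ with vertex $k+1+i$ for $0\le i\le p-1$. Finally link the $i$th unlinked bottom vertex from the left with the $i$th unlinked top vertex from the left, for $1\le i\le n-2p$. Rules. Vectors $v_{k_n}\heartsuit\cdots\heartsuit v_{k_1}$ are computed recursively from words in $\{+,-\}$ (the empty word giving $1\in\mathbb C$) by applying, in any way, the rules: (i) $v_-\heartsuit v_{k_{n-1}}\heartsuit\cdots\heartsuit v_{k_1}=v_-\otimes(v_{k_{n-1}}\heartsuit\cdots\heartsuit v_{k_1})$; (ii) $v_{k_n}\heartsuit\cdots\heartsuit v_{k_2}\heartsuit v_+=(v_{k_n}\heartsuit\cdots\heartsuit v_{k_2})\otimes v_+$; (iii) if $k_i=+$ and $k_{i-1}=-$, then $v_{k_n}\heartsuit\cdots\heartsuit v_{k_{i+1}}\heartsuit v_+\heartsuit v_-\heartsuit v_{k_{i-2}}\heartsuit\cdots\heartsuit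 v_{k_1}=(\mathrm{id}^{\otimes(n-i)}\otimes\delta\otimes\mathrm{id}^{\otimes(i-2)})(v_{k_n}\heartsuit\cdots\heartsuit v_{k_{i+1}}\heartsuit v_{k_{i-2}}\heartsuit\cdots\heartsuit v_{k_1})$. *)

(* Defs.v *)
From HB Require Import structures.
From mathcomp Require Import all_boot all_order all_algebra zify.

Set Implicit Arguments.
Unset Strict Implicit.
Unset Printing Implicit Defensive.

Import GRing.Theory.

(* The letters + and - ; v_+ = v_{vp} and v_- = v_{vm}. *)
Notation vp := true (only parsing).
Notation vm := false (only parsing).

(* (false, j) is the vertex j of the bottom line, (true, j) the vertex j of the
   top line; vertices are numbered from 0, from left to right. *)
Definition vertex (n : nat) := (bool * 'I_n)%type.

(* Rank of a vertex when one runs around the strip: bottom line from left to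
   right, then top line from right to left. Links drawn in the strip can be made
   disjoint iff their end points do not interleave in this cyclic order. *)
Definition rank {n} (x : vertex n) : nat :=
  if x.1 then (n + n).-1 - x.2 else x.2.

Definition is_diagram n (f : {ffun vertex n -> vertex n}) : bool :=
  [&& [forall x, f (f x) == x], [forall x, f x != x]
    & [forall x, forall y,
        ~~ [&& rank x < rank y, rank y < rank (f x) & rank (f x) < rank (f y)]]].

(* An n-diagram, given by the function sending a vertex to the other end of its
   link. *)
Record diagram (n : nat) := Diagram {
  partner :> {ffun vertex n -> vertex n};
  diagramP : is_diagram partner }.

HB.instance Definition _ n := [isSub for @partner n].
HB.instance Definition _ n := [Finite of diagram n by <:].

Lemma is_diagramI n (f : {ffun vertex n -> vertex n}) :
  involutive f -> (forall x, f x != x) ->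
  (forall x y, rank x < rank y -> rank y < rank (f x) ->
     rank (f x) < rank (f y) -> False) ->
  is_diagram f.
Proof.
move=> fK fN fc; apply/and3P; split; first by apply/forallP=> x; rewrite fK.
  exact/forallP.
apply/forallP=> x; apply/forallP=> y; apply/negP=> /and3P[h1 h2 h3].
exact: fc h1 h2 h3.
Qed.

Definition id_fun n : {ffun vertex n -> vertex n} := [ffun x => (~~ x.1, x.2)].

Lemma id_funP n : is_diagram (id_fun n).
Proof.
apply: is_diagramI => [[b i]|[b i]|[b [i hi]] [c [j hj]]]; rewrite !ffunE /=.
- by rewrite negbK.
- by rewrite xpair_eqE; case: b.
- by rewrite /rank; case: b; case: c => /=; lia.
Qed.

Definition id_diagram n : diagram n := Diagram (id_funP n).

Definition e_fun n i (hi : i.+1 < n) : {ffun vertex n -> vertex n} :=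
  [ffun x => if x.2 == Ordinal (ltnW hi) then (x.1, Ordinal hi)
             else if x.2 == Ordinal hi then (x.1, Ordinal (ltnW hi))
             else (~~ x.1, x.2)].

Lemma e_funP n i (hi : i.+1 < n) : is_diagram (e_fun hi).
Proof.
have sN : (Ordinal hi == Ordinal (ltnW hi)) = false.
  by apply/negP=> /eqP[]; lia.
apply: is_diagramI => [[b j]|[b j]|[b j] [c l]]; rewrite !ffunE /=.
- have [->|/negbTE n1] := eqVneq j (Ordinal (ltnW hi)); first by rewrite sN eqxx.
  have [->|/negbTE n2] := eqVneq j (Ordinal hi); first by rewrite eqxx.
  by rewrite n1 n2 negbK.
- have [->|n1] := eqVneq j (Ordinal (ltnW hi)); first by rewrite xpair_eqE sN andbF.
  have [->|n2] := eqVneq j (Ordinal hi).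
    by rewrite xpair_eqE [_ == Ordinal hi]eq_sym sN andbF.
  by rewrite xpair_eqE; case: b.
- rewrite /rank -!val_eqE /=; move: (ltn_ord j) (ltn_ord l).
  by case: eqP => h1; [|case: eqP => h2]; (case: eqP => h3; [|case: eqP => h4]);
    case: b; case: c => /=; lia.
Qed.

(* The generator e_{i+1}. *)
Definition e_diagram n i (hi : i.+1 < n) : diagram n := Diagram (e_funP hi).

(* Stacking D' on top of D: the points are the outer vertices (inl) and the
   vertices of the middle line (inr). *)
Definition stack_point (n : nat) := (vertex n + 'I_n)%type.

Definition lower {n} (x : vertex n) : stack_point n :=
  if x.1 then inr x.2 else inl x.
Definition upper {n} (x : vertex n) : stack_point n :=
  if x.1 then inl x else inr x.2.

Definition stack_edge n (D' D : diagram n) : rel (stack_point n) := fun x y =>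
  [exists u, (x == lower u) && (y == lower (D u))]
  || [exists u, (x == upper u) && (y == upper (D' u))].

Definition is_stack n (D' D D'' : diagram n) : bool :=
  [forall x, forall y,
    (D'' x == y) == (x != y) && connect (stack_edge D' D) (inl x) (inl y)].

(* The closed loops are the components without outer vertices. *)
Definition loops n (D' D : diagram n) : nat :=
  n_comp (stack_edge D' D)
    [pred x | [forall y : vertex n, ~~ connect (stack_edge D' D) x (inl y)]].

(* Below, a word lists k_n, ..., k_1 in this order: position a, counted from 0,
   holds k_(n - a), so that increasing i means decreasing position. *)

Definition is_linked (L : seq (nat * nat)) (a : nat) : bool :=
  has (fun l => (l.1 == a) || (l.2 == a)) L.

(* Treats position a. The greatest j < i is the leftmost position after a. *)
Definition link_step (w : seq bool) (a : nat) (L : seq (nat * nat)) :=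
  if nth vm w a == vp then
    if [seq b <- iota a.+1 (size w - a.+1) | (nth vp w b == vm) && ~~ is_linked L b]
      is b :: _ then (a, b) :: L else L
  else L.

(* foldr treats the last position (i = 1) first. *)
Definition top_links (w : seq bool) : seq (nat * nat) :=
  foldr (link_step w) [::] (iota 0 (size w)).

Definition bottom_links (k p : nat) : seq (nat * nat) :=
  [seq (k - i.+1, k + i) | i <- iota 0 p].

Definition unlinked (n : nat) (L : seq (nat * nat)) : seq nat :=
  [seq a <- iota 0 n | ~~ is_linked L a].

Definition through_links (n : nat) (B T : seq (nat * nat)) : seq (nat * nat) :=
  zip (unlinked n B) (unlinked n T).

Definition d_links (w : seq bool) : seq ((bool * nat) * (bool * nat)) :=
  let T := top_links w in
  let B := bottom_links (count_mem vm w) (size T) in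
  [seq ((true, l.1), (true, l.2)) | l <- T]
  ++ [seq ((false, l.1), (false, l.2)) | l <- B]
  ++ [seq ((false, l.1), (true, l.2)) | l <- through_links (size w) B T].

Definition d_linked (w : seq bool) (n : nat) (x y : vertex n) : bool :=
  let x' := (x.1, val x.2) in let y' := (y.1, val y.2) in
  ((x', y') \in d_links w) || ((y', x') \in d_links w).

Definition d_fun n (w : n.-tuple bool) : {ffun vertex n -> vertex n} :=
  [ffun x => odflt x [pick y | d_linked w x y]].

Lemma is_linkedE L a : is_linked L a = (a \in unzip1 L ++ unzip2 L).
Proof.
rewrite mem_cat; elim: L => //= -[c d] L IH.
rewrite /is_linked /= -/(is_linked L a) IH !inE ![_ == a]eq_sym.
by case: eqP; case: eqP; case: (_ \in _); case: (_ \in _).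
Qed.

Lemma is_linkedP L a :
  reflect (exists b, (a, b) \in L \/ (b, a) \in L) (is_linked L a).
Proof.
apply: (iffP hasP) => [[[c d] cd /orP[]/= /eqP <-]|[b [ab|ba]]].
- by exists d; left.
- by exists c; right.
- by exists (a, b); rewrite //= eqxx.
- by exists (b, a); rewrite //= eqxx orbT.
Qed.

Section Matching.
Variables (T : eqType) (L : seq (T * T)).
Hypothesis uL : uniq (unzip1 L ++ unzip2 L).

Lemma matching_fst x y z : (x, y) \in L -> (x, z) \in L -> y = z.
Proof.
move: uL; rewrite cat_uniq => /andP[u1 _]; elim: L u1 => //= -[a b] l IH /=.
move=> /andP[nal ul]; rewrite !inE.
case/predU1P=> [[-> ->]|h1]; case/predU1P=> [|h2].
- by case.
- by case/negP: nal; apply/mapP; exists (a, z).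
- by case=> e1 _; case/negP: nal; apply/mapP; exists (x, y).
- exact: IH.
Qed.

Lemma matching_snd x y z : (y, x) \in L -> (z, x) \in L -> y = z.
Proof.
move: uL; rewrite cat_uniq => /and3P[_ _ u2]; elim: L u2 => //= -[a b] l IH /=.
move=> /andP[nal ul]; rewrite !inE.
case/predU1P=> [[-> ->]|h1]; case/predU1P=> [|h2].
- by case.
- by case/negP: nal; apply/mapP; exists (z, b).
- by case=> _ e1; case/negP: nal; apply/mapP; exists (y, x).
- exact: IH.
Qed.

Lemma matching_mix x y z : (x, y) \in L -> (z, x) \in L -> False.
Proof.
move: uL; rewrite cat_uniq => /and3P[_ /hasPn dis _] h1 h2.
have /dis/negP : x \in unzip2 L by apply/mapP; exists (z, x).
by apply; apply/mapP; exists (x, y).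
Qed.

Lemma matching_uniq x y z :
  ((x, y) \in L) || ((y, x) \in L) -> ((x, z) \in L) || ((z, x) \in L) -> y = z.
Proof.
case/orP=> h1; case/orP=> h2.
- exact: matching_fst h1 h2.
- by case: (matching_mix h1 h2).
- by case: (matching_mix h2 h1).
- exact: matching_snd h1 h2.
Qed.

End Matching.

Record top_inv (w : seq bool) (m : nat) (L : seq (nat * nat)) : Prop := TopInv {
  ti_uniq : uniq (unzip1 L ++ unzip2 L);
  ti_rng : forall c d, (c, d) \in L ->
    [/\ m <= c, c < d, d < size w, nth vm w c = vp & nth vp w d = vm];
  ti_between : forall c d e, (c, d) \in L -> c < e < d ->
    exists2 e', c < e' < d & (e, e') \in L \/ (e', e) \in L;
  ti_free : forall c b, m <= c -> nth vm w c = vp -> ~~ is_linked L c ->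
    c < b < size w -> nth vp w b = vm -> is_linked L b }.

Lemma top_inv_step w m L : m < size w ->
  top_inv w m.+1 L -> top_inv w m (link_step w m L).
Proof.
move=> lm [uL rL bL fL].
have nlm : ~~ is_linked L m.
  apply/negP=> /is_linkedP[b [/rL[]|/rL[]]]; lia.
have rL' c d : (c, d) \in L ->
    [/\ m <= c, c < d, d < size w, nth vm w c = vp & nth vp w d = vm].
  by case/rL=> *; split=> //; lia.
rewrite /link_step; case: eqP => [wm|/eqP wm]; last first.
  split=> // c b; rewrite leq_eqVlt => /predU1P[<-|]; last exact: fL.
  by move=> h; rewrite h in wm.
case E : [seq b <- _ | _] => [|b l].
  split=> // c b; rewrite leq_eqVlt => /predU1P[<- _ _ lb wb|]; last exact: fL.
  apply/negPn/negP=> nb; suff: b \in [::] by [].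
  by rewrite -E mem_filter wb nb eqxx mem_iota; lia.
have : b \in b :: l by rewrite mem_head.
rewrite -E mem_filter mem_iota => /andP[/andP[/eqP wb nb] hb].
have lmb : m < b < size w by lia.
have bmin b' : m < b' < b -> nth vp w b' = vm -> is_linked L b'.
  move=> hb' wb'; apply/negPn/negP=> nb'.
  have : b' \in b :: l.
    by rewrite -E mem_filter wb' nb' eqxx mem_iota; lia.
  have : sorted ltn (b :: l).
    by rewrite -E; apply: sorted_filter (iota_ltn_sorted _ _); exact: ltn_trans.
  rewrite /= => /(order_path_min ltn_trans)/allP mn.
  by rewrite inE => /predU1P[|/mn]; lia.
have bsym c d e : (c, d) \in L -> c < e < d ->
    exists2 e', c < e' < d & (e, e') \in (m, b) :: L \/ (e', e) \in (m, b) :: L.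
  by move=> h1 h2; have [e' ? [?|?]] := bL c d e h1 h2; exists e' => //;
    rewrite !inE; [left|right]; apply/orP; right.
split.
- rewrite /= mem_cat inE negb_or -andbA.
  move: nlm nb; rewrite !is_linkedE !mem_cat !negb_or.
  case/andP=> n1 n2 /andP[n3 n4]; rewrite n1 /= -cat1s uniq_catCA cat1s /=.
  by rewrite mem_cat negb_or n3 n4 n2 uL andbT /=; lia.
- by move=> c d; rewrite inE => /predU1P[[-> ->]|/rL'//]; split=> //; lia.
- move=> c d e; rewrite inE => /predU1P[[-> ->]|]; last exact: bsym.
  move=> he; case we : (nth vm w e); last first.
    have we' : nth vp w e = vm by rewrite -we; apply: set_nth_default; lia.
    have /is_linkedP[c' [h|h]] := bmin e he we'.
      by case/rL: (h); rewrite we.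
    exists c'; last by right; rewrite inE h orbT.
    by case/rL: (h); lia.
  have le : is_linked L e.
    apply/negPn/negP=> ne; have := fL e b _ we ne _ wb.
    by rewrite (negbTE nb) => h; suff: false by []; apply: h; lia.
  case/is_linkedP: le => c' [h|h]; last first.
    have [_ _ se _ we'] := rL _ _ h.
    by move: we'; rewrite (set_nth_default vm) ?we.
  exists c'; last by left; rewrite inE h orbT.
  have [_ h1 h2 _ wc'] := rL _ _ h.
  case: (ltngtP c' b) => [||eb]; first by lia.
    move=> lbc; have ebc : e < b < c' by lia.
    have [b' _ hb'] := bL _ _ b h ebc.
    by case/negP: nb; apply/is_linkedP; exists b'.
  by case/negP: nb; rewrite -eb; apply/is_linkedP; exists e; right.
- move=> c b'; rewrite leq_eqVlt => /predU1P[<- _|].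
    by rewrite /is_linked /= eqxx.
  move=> lc wc; rewrite /is_linked /= => /norP[_ nc] hb' wb'.
  by rewrite -/(is_linked L b') (fL c b') ?orbT.
Qed.

Lemma top_linksP w : top_inv w 0 (top_links w).
Proof.
rewrite /top_links.
suff H m s : m + s = size w -> top_inv w m (foldr (link_step w) [::] (iota m s)).
  exact: H.
elim: s m => [|s IH] m /= E.
  split=> // c b hc wc _ hb; lia.
by apply: top_inv_step; [lia | apply: IH; lia].
Qed.

Lemma uniq_positions (w : seq bool) (x0 b : bool) (s : seq nat) :
  uniq s -> {in s, forall a, a < size w /\ nth x0 w a = b} ->
  size s <= count_mem b w.
Proof.
move=> us hs.
have -> : count_mem b w = size [seq a <- iota 0 (size w) | nth x0 w a == b].
  rewrite size_filter -[in LHS](mkseq_nth x0 w) /mkseq count_map.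
  exact: eq_count.
apply: uniq_leq_size => // a /hs[h1 h2]; rewrite mem_filter h2 eqxx mem_iota.
by rewrite add0n.
Qed.

Section DFun.
Variables (n : nat) (w : n.-tuple bool).
Let T := top_links w.
Let k := count_mem vm w.
Let p := size T.
Let B := bottom_links k p.

Let TP : top_inv w 0 T. Proof. exact: top_linksP. Qed.

Let p_le_k : p <= k.
Proof.
have := ti_uniq TP; rewrite cat_uniq => /and3P[_ _ u2].
have -> : p = size (unzip2 T) by rewrite size_map.
apply: (@uniq_positions w vp) u2 _ => d /mapP[[c d'] h -> /=].
by case: (ti_rng TP h).
Qed.

Let p_le_nk : p + k <= n.
Proof.
have := ti_uniq TP; rewrite cat_uniq => /and3P[u1 _ _].
have h1 : p <= count_mem vp w.
  have -> : p = size (unzip1 T) by rewrite size_map.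
  apply: (@uniq_positions w vm) u1 _ => c /mapP[[c' d] h -> /=].
  by case: (ti_rng TP h) => *; split=> //; lia.
have := count_predC (pred1 vm) w; rewrite size_tuple -/k.
have -> : count (predC (pred1 vm)) w = count_mem vp w by apply: eq_count; case.
lia.
Qed.

Let B_linked a : is_linked B a = (k - p <= a < k + p).
Proof.
apply/is_linkedP/idP => [[b []/mapP[i]]|h].
- by rewrite mem_iota => hi [-> _]; lia.
- by rewrite mem_iota => hi [_ ->]; lia.
- case: (ltnP a k) => hk.
    exists (k + (k - a.+1)); left; apply/mapP; exists (k - a.+1).
      by rewrite mem_iota; lia.
    by congr (_, _); lia.
  exists (k - (a - k).+1); right; apply/mapP; exists (a - k).
    by rewrite mem_iota; lia.
  by congr (_, _); lia.
Qed.

Let B_uniq : uniq (unzip1 B ++ unzip2 B).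
Proof.
rewrite cat_uniq /unzip1 /unzip2 -!map_comp; apply/and3P; split.
- rewrite map_inj_in_uniq ?iota_uniq // => i j; rewrite !mem_iota /=; lia.
- apply/hasPn=> x /mapP[i hi ->]; apply/negP=> /mapP[j].
  by move: hi; rewrite !mem_iota /=; lia.
- rewrite map_inj_in_uniq ?iota_uniq // => i j; rewrite !mem_iota /=; lia.
Qed.

Let fB := unlinked n B.
Let fT := unlinked n T.

Let size_unlinked (L : seq (nat * nat)) : uniq (unzip1 L ++ unzip2 L) ->
  {in unzip1 L ++ unzip2 L, forall a, a < n} ->
  size (unlinked n L) = n - (size L + size L).
Proof.
move=> uL hL.
have -> : n - (size L + size L) = n - size (unzip1 L ++ unzip2 L).
  by rewrite size_cat !size_map.
have /perm_size : perm_eq (unlinked n L ++ (unzip1 L ++ unzip2 L)) (iota 0 n).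
  apply: uniq_perm (iota_uniq _ _) _.
    rewrite cat_uniq uL andbT filter_uniq ?iota_uniq //=.
    by apply/hasPn=> a ha; rewrite mem_filter is_linkedE ha.
  move=> a; rewrite mem_cat mem_filter is_linkedE mem_iota add0n /=.
  by case h: (a \in _ ++ _); rewrite ?(hL _ h) // orbF.
rewrite size_iota (size_cat (unlinked n L)) => E.
by apply: (canRL (addnK _)); exact: E.
Qed.

Let size_fB : size fB = n - (p + p).
Proof.
rewrite size_unlinked //; first by rewrite size_map size_iota.
by move=> a; rewrite -is_linkedE B_linked; move: p_le_nk; lia.
Qed.

Let size_fT : size fT = n - (p + p).
Proof.
rewrite size_unlinked //; first exact: ti_uniq TP.
move=> a; rewrite -is_linkedE => /is_linkedP[b [/(ti_rng TP)[]|/(ti_rng TP)[]]];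
  rewrite size_tuple; lia.
Qed.

Let size_f : size fB = size fT. Proof. by rewrite size_fB size_fT. Qed.

Let fst_thr : unzip1 (zip fB fT) = fB.
Proof. by rewrite unzip1_zip ?size_f. Qed.
Let snd_thr : unzip2 (zip fB fT) = fT.
Proof. by rewrite unzip2_zip ?size_f. Qed.

Let fP L a : (a \in unlinked n L) = (a < n) && ~~ is_linked L a.
Proof. by rewrite mem_filter mem_iota add0n andbC. Qed.

Let d_ends : d_links w =
  [seq ((true, l.1), (true, l.2)) | l <- T]
  ++ [seq ((false, l.1), (false, l.2)) | l <- B]
  ++ [seq ((false, l.1), (true, l.2)) | l <- zip fB fT].
Proof. by rewrite /d_links /through_links size_tuple. Qed.

Let ends_perm : perm_eq (unzip1 (d_links w) ++ unzip2 (d_links w))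
  ([seq (true, a) | a <- (unzip1 T ++ unzip2 T) ++ fT]
   ++ [seq (false, a) | a <- (unzip1 B ++ unzip2 B) ++ fB]).
Proof.
have E1 : [seq (false, a) | a <- fB] = [seq (false, l.1) | l <- zip fB fT].
  by rewrite -{1}fst_thr /unzip1 -map_comp.
have E2 : [seq (true, a) | a <- fT] = [seq (true, l.2) | l <- zip fB fT].
  by rewrite -{1}snd_thr /unzip2 -map_comp.
rewrite d_ends !map_cat E1 E2 /unzip1 /unzip2 !map_cat -!map_comp.
apply/permP=> P; rewrite !count_cat /comp /=; do 6!move: (count P _) => ?; lia.
Qed.

Let d_uniq : uniq (unzip1 (d_links w) ++ unzip2 (d_links w)).
Proof.
rewrite (perm_uniq ends_perm) cat_uniq !map_inj_uniq; try by move=> ? ? [].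
apply/and3P; split.
- rewrite cat_uniq (ti_uniq TP) filter_uniq ?iota_uniq // andbT /=.
  by apply/hasPn=> a; rewrite fP -is_linkedE => /andP[].
- by apply/hasPn=> x /mapP[a _ ->]; apply/negP=> /mapP[].
- rewrite cat_uniq B_uniq filter_uniq ?iota_uniq // andbT /=.
  by apply/hasPn=> a; rewrite fP -is_linkedE => /andP[].
Qed.

Let d_total b a : a < n -> (b, a) \in unzip1 (d_links w) ++ unzip2 (d_links w).
Proof.
move=> ha; rewrite (perm_mem ends_perm) mem_cat; case: b; apply/orP; [left|right];
  by apply/mapP; exists a => //; rewrite mem_cat fP -is_linkedE ha /= orbN.
Qed.

Let d_rng x y : (x, y) \in d_links w -> x.2 < n /\ y.2 < n.
Proof.
move=> xy; have H z : z \in unzip1 (d_links w) ++ unzip2 (d_links w) -> z.2 < n.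
  rewrite (perm_mem ends_perm) mem_cat => /orP[]/mapP[a ha -> /=]; move: ha;
    rewrite mem_cat fP -is_linkedE => /orP[h|/andP[]//].
    case/is_linkedP: h => c [/(ti_rng TP)[]|/(ti_rng TP)[]]; rewrite size_tuple; lia.
  by move: h; rewrite B_linked; move: p_le_nk; lia.
by split; apply: H; rewrite mem_cat; apply/orP; [left|right]; apply/mapP;
  exists (x, y).
Qed.

Let lk_ex (x : vertex n) : exists y : vertex n, d_linked w x y.
Proof.
have := d_total x.1 (ltn_ord x.2); rewrite mem_cat.
case/orP=> /mapP[[u v] h /= E]; have /= [hu hv] := d_rng h.
  exists (v.1, Ordinal hv); rewrite /d_linked /=.
  by case: v h hv => [v1 v2] /= h hv; rewrite E h.
exists (u.1, Ordinal hu); rewrite /d_linked /=.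
by case: u h hu E => [u1 u2] /= h hu E; rewrite E h orbT.
Qed.

Let lk_fun (x y1 y2 : vertex n) : d_linked w x y1 -> d_linked w x y2 -> y1 = y2.
Proof.
case: y1 y2 => [b1 j1] [b2 j2] h1 h2.
by have [-> /val_inj ->] := matching_uniq d_uniq h1 h2.
Qed.

Let lkP (x y : vertex n) : reflect (d_fun w x = y) (d_linked w x y).
Proof.
have hx : d_linked w x (d_fun w x).
  have [y0 hy0] := lk_ex x.
  by rewrite /d_fun ffunE; case: pickP => [//|/(_ y0)]; rewrite hy0.
by apply: (iffP idP) => [/(lk_fun hx)|<-].
Qed.

Let lk_sym (x y : vertex n) : d_linked w x y = d_linked w y x.
Proof. by rewrite /d_linked orbC. Qed.

Let lk_cases (x y : vertex n) : d_linked w x y -> rank x < rank y ->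
  [\/ exists i, [/\ i < p, x.1 = false, y.1 = false & x.2 = k - i.+1 :> nat /\
        y.2 = k + i :> nat],
      exists i, [/\ i < size fB, x.1 = false, y.1 = true & x.2 = nth 0 fB i :> nat /\
        y.2 = nth 0 fT i :> nat]
    | [/\ x.1 = true, y.1 = true & (val y.2, val x.2) \in T]].
Proof.
case: x y => [b [i hi]] [c [j hj]]; rewrite /d_linked /= d_ends !mem_cat /rank /=.
have inT c' d' : (c', d') \in T -> c' < d' by case/(ti_rng TP).
have inZ c' d' : (c', d') \in zip fB fT -> exists2 i, i < size fB &
    c' = nth 0 fB i /\ d' = nth 0 fT i.
  case/(nthP (0, 0))=> m; rewrite size_zip size_f minnn -size_f => hm.
  by rewrite nth_zip // => -[<- <-]; exists m.
case/orP=> /or3P[]/mapP[[c' d'] h [-> E1 -> E2]] /= R; subst.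
- by have := inT _ _ h; lia.
- constructor 1; case/mapP: h => m; rewrite mem_iota => hm [E1 E2].
  by exists m; split=> //; lia.
- by constructor 2; have [m hm [E1 E2]] := inZ _ _ h; exists m.
- by constructor 3.
- by case/mapP: h => m; rewrite mem_iota => hm [E1 E2]; lia.
- lia.
Qed.

Lemma d_funP : is_diagram (d_fun w).
Proof.
apply: is_diagramI => [x|x|x y].
- by apply/lkP; rewrite lk_sym; apply/lkP.
- apply/negP=> /eqP/lkP; rewrite /d_linked orbb => h.
  exact: (matching_mix d_uniq h h).
have mono L i j : i < j -> j < size (unlinked n L) ->
    nth 0 (unlinked n L) i < nth 0 (unlinked n L) j.
  move=> ij hj; apply: (sorted_ltn_nth ltn_trans) => //.
    by apply: sorted_filter (iota_ltn_sorted _ _); exact: ltn_trans.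
  by rewrite inE (ltn_trans ij).
have mB := mono B; have mT := mono T; rewrite -/fB -/fT in mB mT.
have fBP i : i < size fB -> nth 0 fB i < k - p \/ k + p <= nth 0 fB i.
  move=> hi; have := mem_nth 0 hi; rewrite fP B_linked => /andP[_].
  by rewrite negb_and -ltnNge -leqNgt => /orP[]; [left|right].
have fTP i : i < size fB -> ~~ is_linked T (nth 0 fT i).
  by rewrite size_f => hi; have := mem_nth 0 hi; rewrite fP => /andP[].
have hx : d_linked w x (d_fun w x) by apply/lkP.
have hy : d_linked w y (d_fun w y) by apply/lkP.
move: (d_fun w x) (d_fun w y) hx hy => x' y' hx hy r1 r2 r3.
have rx := ltn_trans r1 r2; have ry := ltn_trans r2 r3.
have := lk_cases hx rx; have := lk_cases hy ry; move: r1 r2 r3 {hx hy rx ry}.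
case: x x' y y' => [? [x hx]] [? [x' hx']] [? [y hy]] [? [y' hy']].
rewrite /rank /= => r1 r2 r3.
case=> [[i [hi e1 e2 [e3 e4]]]|[i [hi e1 e2 [e3 e4]]]|[e1 e2 hi]];
case=> [[j [hj e5 e6 [e7 e8]]]|[j [hj e5 e6 [e7 e8]]]|[e5 e6 hj]];
  subst; move: r1 r2 r3 => /= r1 r2 r3; try lia.
- by have := fBP _ hi; lia.
- have [ij|ij|ij] := ltngtP i j; last by rewrite ij ltnn in r1.
    have := mB _ _ ij hj; lia.
  have := mT _ _ ij; rewrite -size_f => /(_ hi); lia.
- have yj : y' < nth 0 fT j < y by lia.
  have [e' _ he] := ti_between TP hi yj.
  by case/negP: (fTP _ hj); apply/is_linkedP; exists e'.
- have yx : x' < y < x by lia.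
  have [e' h1 he] := ti_between TP hj yx.
  have h2 : ((y, y') \in T) || ((y', y) \in T) by rewrite hi orbT.
  by have := matching_uniq (ti_uniq TP) h2 (introT orP he); lia.
Qed.

End DFun.

(* d(k_n, ..., k_1) for w = (k_n, ..., k_1). *)
Definition d_diagram n (w : n.-tuple bool) : diagram n := Diagram (d_funP w).

Local Open Scope ring_scope.

Section TemperleyLieb.
Variables (F : fieldType) (q : F).

(* The vector space with basis the n-diagrams, in coordinates. *)
Definition TL (n : nat) := {ffun diagram n -> F^o}.

Definition tl_diag n (D : diagram n) : TL n := [ffun D' => (D' == D)%:R].

Definition tl_one n : TL n := tl_diag (id_diagram n).

Definition tl_mul n (x y : TL n) : TL n :=
  [ffun D'' => \sum_(D' : diagram n) \sum_(D : diagram n | is_stack D' D D'')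
                 x D' * y D * (- q - q^-1) ^+ loops D' D].

(* The space (F^2)^{(x) n}, in coordinates: t = (b_1, ..., b_n) indexes the basis
   vector v_{b_1} (x) ... (x) v_{b_n}. The space for n = 0 is identified with F. *)
Definition tens (n : nat) := {ffun n.-tuple bool -> F^o}.

(* Coordinate of x at a word, 0 if the word does not have length n; together with
   the free target degrees below, this avoids casts between equal degrees. *)
Definition coef n (x : tens n) (s : seq bool) : F :=
  if insub s is Some t then x t else 0.

(* v_{b_1} (x) ... (x) v_{b_n} for s = (b_1, ..., b_n). *)
Definition basis n (s : seq bool) : tens n := [ffun t => (tval t == s)%:R].

Definition vect (b : bool) : tens 1 := basis 1 [:: b].

(* x (x) y; meant for n = m + p. *)
Definition tensor n m p (x : tens m) (y : tens p) : tens n :=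
  [ffun t : n.-tuple bool => coef x (take m t) * coef y (drop m t)].

(* (id^{(x) a} (x) f (x) id^{(x) b}) x for a linear f; meant for n = a + m + b and
   n' = a + p + b. *)
Definition amplify n n' m p (a : nat) (f : tens m -> tens p) (x : tens n) : tens n' :=
  [ffun t : n'.-tuple bool => coef
     (f [ffun s : m.-tuple bool => coef x (take a t ++ s ++ drop (a + p) t)])
     (take p (drop a t))].

Definition epsilon (x : tens 2) : tens 0 :=
  [ffun => - q * coef x [:: vp; vm] + coef x [:: vm; vp]].

Definition delta (z : tens 0) : tens 2 :=
  coef z [::] *: (basis 2 [:: vp; vm] - q^-1 *: basis 2 [:: vm; vp]).

(* rho makes the tensor space a unital TL_n-module on which the generators act by
   id (x) (delta o epsilon) (x) id. The generators e_i generate the algebra TL_n,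
   so rho is determined by these conditions. *)
Record is_TL_action n (rho : TL n -> tens n -> tens n) : Prop := IsTLAction {
  action_linear : forall x, linear (rho x);
  action_linearl : forall v, linear (rho^~ v);
  action1 : forall v, rho (tl_one n) v = v;
  actionM : forall x y v, rho (tl_mul x y) v = rho x (rho y v);
  action_e : forall i (hi : (i.+1 < n)%N) v,
    rho (tl_diag (e_diagram hi)) v = amplify n i (delta \o epsilon) v }.

(* heart w x: some way of applying the rules to the word w yields x. *)
Inductive heart : forall n : nat, seq bool -> tens n -> Prop :=
| heart_nil : heart [::] (basis 0 [::])
| heart_minus n w (x : tens n) :
    heart w x -> heart (vm :: w) (tensor n.+1 (vect vm) x)
| heart_plus n w (x : tens n) :
    heart w x -> heart (rcons w vp) (tensor n.+1 x (vect vp))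
| heart_delta n w1 w2 (x : tens n) :
    heart (w1 ++ w2) x ->
    heart (w1 ++ vp :: vm :: w2) (amplify n.+2 (size w1) delta x).

End TemperleyLieb.

(* Main.v *)
Require Import Defs.
From mathcomp Require Import all_boot all_order all_algebra zify.
From mathcomp Require Import reals complex.

(** Every word is obtained from a sorted one, -...-+...+, by successively replacing
    a pair -+ at positions i, i + 1 by +-. Both sides of the theorem behave in
    the same way along this process.

    On sorted words the diagram is the identity (d_diagram_sorted) and the heart
    product is the basis vector itself (heart_coef_sorted).

    If w arises from w' by replacing -+ with +-, then d(w) = e_i d(w') and no closed
    loop appears (d_diagram_swap, cap_is_stack, cap_loops). A planar matching is
    determined by the set of those vertices that precede their partners when one runs
    around the strip (opener_inj). For d(w) this set is read off from the number
    of links and from the - letters that are linked on the top line (d_opener);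
    for e_i d(w') it is that of d(w') up to at most three vertices (cap_opener).
    Which letters are linked is controlled by a lattice path, + being a step up
    and - a step down: links are its excursions (top_links_height), and passing
    from w' to w moves a single point of the path (matched_swap).

    On the side of vectors, delta epsilon at i turns the heart product of w' into
    that of w, because epsilon cancels the pair -+ (heart_coef_cap) and rule (iii)
    inserts delta. This rests on an explicit formula for the coordinates of
    the heart product (heart_coef), which also shows that it is independent of
    the way in which the rules are applied (heartP).

    An action of the algebra with prescribed generators e_i is thus known on d(w)
    applied to the sorted basis vector, by induction on the number of inversions
    (d_diagram_action). *)

Set Implicit Arguments.
Unset Strict Implicit.
Unset Printing Implicit Defensive.

Import Order.TTheory GRing.Theory Num.Theory.

(** * Linked letters and lattice paths *)

Section Heights.
Local Open Scope ring_scope.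

(** The lattice path of a word: + is a step up and - a step down. *)
Definition height (w : seq bool) (m : nat) : int :=
  (count_mem vp (take m w))%:Z - (count_mem vm (take m w))%:Z.

Lemma heightS w m : (m < size w)%N ->
  height w m.+1 = height w m + (if nth vm w m then 1 else -1).
Proof.
move=> lm; rewrite /height (take_nth vm lm) -cats1 !count_cat /=.
by case: (nth _ _ _) => /=; lia.
Qed.

Lemma height_swap u v m :
  height (u ++ [:: vp, vm & v]) m =
  height (u ++ [:: vm, vp & v]) m + (if m == (size u).+1 then 2 else 0).
Proof.
rewrite /height !take_cat; case: ltnP => [lm|]; first by case: eqP; lia.
move=> /subnKC <-; case: (m - size u)%N => [|[|j]]; rewrite addKn /=;
  rewrite ?count_cat /= ?take0 /=; case: eqP; lia.
Qed.

(** A link is an excursion of the path above its starting height. Everything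
    strictly below a link is linked there, so that stretch of the word is a
    concatenation of shorter links, each of which is an excursion by induction. *)
Lemma top_inv_height w L : top_inv w 0 L ->
  (forall c d, (c, d) \in L -> height w d.+1 = height w c /\
     forall e, (c < e <= d)%N -> height w c < height w e).
Proof.
move=> [uL rL bL fL] c d; have [N] := ubnP (d - c); elim: N c d => // N IH c d le cd.
have [_ lcd ld wc wd] := rL _ _ cd.
have wd' : nth vm w d = vm by rewrite (set_nth_default vp).
(* A stretch [m, d) closed under linking starts with a link (m, m'), and
   what follows m' is again closed; hence the path returns to its height. *)
have run M m : (d - m < M)%N -> (c < m <= d)%N ->
    (forall e, m <= e < d ->
       exists2 e', m <= e' < d & (e, e') \in L \/ (e', e) \in L)%N ->
    height w m = height w d /\ forall e, (m <= e <= d)%N -> height w m <= height w e.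
  elim: M m => // M IHM m lM hm stab.
  have [<-|nm] := eqVneq m d; first by split=> // e he; have -> : e = m by lia.
  have [|m' hm' mm'] := stab m; first by lia.
  have {}mm' : (m, m') \in L by case: mm' => // h; have [_ ? _ _ _] := rL _ _ h; lia.
  have [_ lmm' _ _ _] := rL _ _ mm'.
  have [|hE hgt] := IH m m' _ mm'; first by lia.
  have stab' e : (m' < e < d)%N ->
      exists2 e', (m' < e' < d)%N & (e, e') \in L \/ (e', e) \in L.
    move=> he; have [|e' he' ee'] := stab e; first by lia.
    exists e' => //; have [|le'] := ltnP m' e'; first by lia.
    have [em|ne] := eqVneq e' m.
      have := @matching_uniq _ _ uL e' m' e; rewrite em mm' => /(_ isT).
      rewrite -em orbC => /(_ (introT orP ee')); lia.
    have [em|ne'] := eqVneq e' m'.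
      have := @matching_uniq _ _ uL e' m e; rewrite em mm' orbT => /(_ isT).
      rewrite -em orbC => /(_ (introT orP ee')); lia.
    have [|e'' he'' e'e''] := bL m m' e' mm'; first by lia.
    have := @matching_uniq _ _ uL e' e e''; rewrite orbC (introT orP ee').
    rewrite (introT orP e'e'') => /(_ isT isT); lia.
  have [h1 h2] : height w m'.+1 = height w d /\
      forall e, (m' < e <= d)%N -> height w m'.+1 <= height w e.
    by apply: IHM stab'; lia.
  split=> [|e he]; first by rewrite -h1 hE.
  have [em'|em'] := leqP e m'; last by rewrite -hE; apply: h2; lia.
  by have [->//|ne] := eqVneq e m; apply/ltW/hgt; lia.
have hc := heightS (ltn_trans lcd ld); rewrite wc in hc.
have [||h1 h2] := run _ c.+1 (ltnSn _); first by lia.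
  move=> e he; have [|e' he' ee'] := bL c d e cd; first by lia.
  by exists e' => //; lia.
have := heightS ld; rewrite wd' => hd; split; first by lia.
by move=> e he; have := h2 e; lia.
Qed.

(** Conversely, for an excursion from c to d + 1 the linking rule leaves no other
    partner for c and d: a different link at c or d would be an excursion too,
    and two excursions sharing one end coincide; if c were free, d would be linked
    by maximality, again along an excursion. *)
Lemma top_links_height w c d : reflect
  [/\ (c < d < size w)%N, height w d.+1 = height w c
    & forall e, (c < e <= d)%N -> height w c < height w e]
  ((c, d) \in top_links w).
Proof.
have [uL rL bL fL] := top_linksP w.
have hL := top_inv_height (top_linksP w).
apply: (iffP idP) => [cd|[/andP[lcd ld] hcd hgt]].
  have [_ -> -> _ _] := rL _ _ cd; have [h1 h2] := hL _ _ cd; by split.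
have wc : nth vm w c = vp.
  have := heightS (ltn_trans lcd ld); have := hgt c.+1; rewrite ltnS leqnn lcd.
  by case: (nth _ _ _) => // /(_ isT); lia.
have wd : nth vp w d = vm.
  rewrite (set_nth_default vm) //; have := heightS ld; have := hgt d.
  by rewrite lcd leqnn; case: (nth _ _ _) => // /(_ isT); lia.
have [/is_linkedP[d' [cd'|dc]]|nl] := boolP (is_linked (top_links w) c).
- have [_ lcd' ld' _ _] := rL _ _ cd'; have [h1 h2] := hL _ _ cd'.
  have [lt|lt|<-//] := ltngtP d' d; first by have := hgt d'.+1; lia.
  by have := h2 d.+1; lia.
- have [_ _ lc _] := rL _ _ dc; by rewrite (set_nth_default vm) ?wc.
have /is_linkedP[c' [h|c'd]] : is_linked (top_links w) d.
- by apply: (fL c) => //; rewrite lcd.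
- by have [_ _ _ + _] := rL _ _ h; rewrite (set_nth_default vp) ?wd.
have [_ lcd' _ _ _] := rL _ _ c'd; have [h1 h2] := hL _ _ c'd.
have [lt|lt|->//] := ltngtP c c'; first by have := hgt c'; lia.
by have := h2 c; lia.
Qed.

Definition matched_minus (w : seq bool) (x : nat) : bool :=
  (nth vp w x == vm) && is_linked (top_links w) x.

(** A - can be linked iff the path was at most as high before as it is just after
    this step: the last such moment starts the excursion. *)
Lemma matched_minus_height w x : reflect
  [/\ (x < size w)%N, nth vp w x = vm
    & exists2 e, (e <= x)%N & height w e <= height w x.+1]
  (matched_minus w x).
Proof.
apply: (iffP andP) => [[/eqP wx /is_linkedP[c [h|h]]]|[lx wx [e0 le0 he0]]].
- have [_ ? ? + _] := ti_rng (top_linksP w) h.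
  by rewrite (set_nth_default vp) ?wx //; lia.
- have [_ lc lx _ _] := ti_rng (top_linksP w) h.
  have /top_links_height[_ hx _] := h.
  by split=> //; exists c; [exact: ltnW | rewrite hx].
have ex : exists e, (e <= x)%N && (height w e <= height w x.+1).
  by exists e0; rewrite le0.
have ub e : (e <= x)%N && (height w e <= height w x.+1) -> (e <= x)%N by case/andP.
split; first by rewrite wx.
case: (ex_maxnP ex ub) => e /andP[lex hle] emax.
have ngt e' : (e < e' <= x)%N -> height w x.+1 < height w e'.
  move=> he'; rewrite ltNge; apply/negP=> h; have := emax e'; rewrite h; lia.
have wx' : nth vm w x = vm by rewrite (set_nth_default vp).
have hx := heightS lx; rewrite wx' in hx.
have ltex : (e < x)%N.
  by rewrite ltn_neqAle lex andbT; apply/eqP=> E; move: hle; rewrite E; lia.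
have eqh : height w e = height w x.+1.
  have := ngt e.+1; rewrite ltnS leqnn ltex => /(_ isT).
  by rewrite (@heightS w e) ?(ltn_trans ltex) //; case: (nth _ _ _); lia.
apply/is_linkedP; exists e; right; apply/top_links_height; split=> //.
  by rewrite ltex.
by rewrite eqh.
Qed.

Section Swap.
Variables u v : seq bool.
Let i := size u.
Let w := u ++ [:: vp, vm & v].
Let w' := u ++ [:: vm, vp & v].

Let lw : (i.+1 < size w)%N. Proof. by rewrite /w size_cat /=; lia. Qed.
Let sw : size w = size w'. Proof. by rewrite !size_cat. Qed.

Lemma nth_swap x0 x : x != i -> x != i.+1 -> nth x0 w x = nth x0 w' x.
Proof.
rewrite /w /w' /i !nth_cat => n1 n2; case: ltnP => // le.
have : (x - size u != 0)%N && (x - size u != 1)%N by lia.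
by case: (x - size u)%N => [|[|j]].
Qed.

Lemma nth_pair x0 b c s : nth x0 (u ++ [:: b, c & s]) i = b /\
  nth x0 (u ++ [:: b, c & s]) i.+1 = c.
Proof. by rewrite !nth_cat ltnn subnn ltnNge leqnSn subSnn. Qed.

Lemma matched_swap_pair :
  [/\ matched_minus w i = false, matched_minus w i.+1 = true
    & matched_minus w' i.+1 = false].
Proof.
have [w1 w2] := nth_pair vp vp vm v; have [_ w3] := nth_pair vp vm vp v.
rewrite /matched_minus -/w -/w' in w1 w2 w3 *; rewrite w1 w3; split=> //.
rewrite w2 eqxx; apply/is_linkedP; exists i; right; apply/top_links_height.
have [w1' w2'] := nth_pair vm vp vm v; rewrite -/w in w1' w2'.
have h1 := heightS (ltnW lw); have h2 := heightS lw; rewrite w1' in h1; rewrite w2' in h2.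
split=> [||e he]; [lia|lia|].
have -> : e = i.+1 by lia.
lia.
Qed.

(** How linkedness of the other - letters changes when +- is replaced by -+ at
    positions i and i + 1. Only the point i + 1 of the path moves, down by 2. The
    - at x is affected only if this lower point is the sole witness for it, that
    is, if x is linked with the + at i + 1 and the - at i is free. *)
Lemma matched_swap x : x != i -> x != i.+1 ->
  matched_minus w x =
  matched_minus w' x && (matched_minus w' i || ((i.+1, x) \notin top_links w')).
Proof.
move=> n1 n2; have hs := height_swap u v; rewrite -/w -/w' -/i in hs.
have [w1 w2] := nth_pair vm vp vm v; have [w3 w4] := nth_pair vm vm vp v.
rewrite -/w -/w' in w1 w2 w3 w4.
have h1 := heightS (ltnW lw); have h2 := heightS lw; rewrite w1 in h1; rewrite w2 in h2.
have hx : height w x.+1 = height w' x.+1 by rewrite hs; case: eqP; lia.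
have hi : height w i = height w' i by rewrite hs; case: eqP; lia.
have hi1 : height w i.+1 = height w' i.+1 + 2 by rewrite hs eqxx.
have he e : e != i.+1 -> height w e = height w' e.
  by move=> /negbTE ne; rewrite hs ne addr0.
apply/matched_minus_height/andP.
  case=> lx wx [e le hle]; split.
    apply/matched_minus_height; rewrite -sw -nth_swap //; split=> //.
    exists e => //; move: hle; rewrite hs hx; case: eqP => _; lia.
  apply/orP; have [h|h] := boolP ((i.+1, x) \in top_links w'); [left|by right].
  have /top_links_height[/andP[lix _] hxi hgt] := h.
  apply/matched_minus_height; rewrite -sw; split.
  - by rewrite ltnW.
  - by case: (nth_pair vp vm vp v).
  have [ei|ne] := eqVneq e i.+1.
    by exists i => //; rewrite ei in hle; lia.
  have lei : (e <= i)%N.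
    by rewrite leqNgt; apply/negP=> lt; have := hgt e; rewrite -(he e) //; lia.
  by exists e => //; rewrite -he // -hxi -hx.
case=> /matched_minus_height[lx wx [e le hle]] alt.
rewrite -sw in lx; split=> //; first by rewrite nth_swap.
have [ei|ne] := eqVneq e i.+1; last by exists e; rewrite ?he ?hx.
have lix : (i.+1 < x)%N by lia.
case/orP: alt => [/matched_minus_height[_ _ [e' le' he']]|nh].
  exists e'; first by lia.
  by rewrite he ?hx; [rewrite ei in hle; exact: le_trans hle | lia].
have [all_gt|] := boolP (all (fun e => height w x.+1 < height w e) (iota 0 x.+1)).
  case/negP: nh; apply/top_links_height; rewrite -sw.
  have gt e' : (e' <= x)%N -> height w x.+1 < height w e'.
    by move=> h; apply: (allP all_gt); rewrite mem_iota.
  have gi := gt i; have E : height w' x.+1 = height w' i.+1 by rewrite ei in hle; lia.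
  split=> // [|e' he']; first by rewrite lix.
  by rewrite -E -hx -he ?gt //; lia.
case/allPn=> e'; rewrite mem_iota => he'; rewrite -leNgt => hle'; exists e' => //; lia.
Qed.

End Swap.

End Heights.

(** * Planar matchings and stacking a generator *)

Section Diagrams.
Variable n : nat.
Implicit Types (A B D : diagram n) (x y : vertex n).

Lemma rank_inj : injective (@rank n).
Proof.
move=> [b x] [c y]; rewrite /rank /= => h.
have [-> xy] : b = c /\ x = y :> nat.
  by move: h; have := ltn_ord x; have := ltn_ord y; case: b; case: c => /=; lia.
by congr (_, _); apply: val_inj.
Qed.

Lemma partnerK D : involutive D.
Proof. by move=> x; case/and3P: (diagramP D) => /forallP/(_ x)/eqP. Qed.

Lemma partner_neq D x : D x != x.
Proof. by case/and3P: (diagramP D) => _ /forallP/(_ x). Qed.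

(** The chord joining x and f x separates y from the starting point of the run
    around the strip; exclusive or makes separation additive in the end points. *)
Definition separates (f : vertex n -> vertex n) x y : bool :=
  (rank x < rank y) (+) (rank (f x) < rank y).

Lemma partner_planar D x y : y != x -> y != D x -> separates D x y = separates D x (D y).
Proof.
move=> n1 n2.
have n3 : D y != x by apply: contra_neq n2 => <-; rewrite partnerK.
have n4 : D y != D x by rewrite (inj_eq (inv_inj (@partnerK D))).
move: (partner_neq D x) (partner_neq D y) n1 n2 n3 n4.
rewrite -!(inj_eq rank_inj) /separates.
have nc u v : (rank u < rank v < rank (D u)) && (rank (D u) < rank (D v)) = false.
  case/and3P: (diagramP D) => _ _ /forallP/(_ u)/forallP/(_ v).
  by rewrite andbA => /negbTE.
have := (nc x y, nc (D x) y, nc x (D y), nc (D x) (D y)).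
have := (nc y x, nc (D y) x, nc y (D x), nc (D y) (D x)).
rewrite !partnerK.
move: (rank x) (rank y) (rank (D x)) (rank (D y)) => a b c d.
move=> [[[h1 h2] h3] h4] [[[h5 h6] h7] h8]; lia.
Qed.

Lemma planar_is_diagram (f : {ffun vertex n -> vertex n}) :
  involutive f -> (forall x, f x != x) ->
  (forall x y, y != x -> y != f x -> separates f x y = separates f x (f y)) ->
  is_diagram f.
Proof.
move=> fK fN fs; apply: is_diagramI => // x y r1 r2 r3.
have := fs x y; rewrite -!(inj_eq rank_inj) /separates.
move: r1 r2 r3; move: (rank x) (rank y) (rank (f x)) (rank (f y)) => a b c d *; lia.
Qed.

(** Running around the strip, one meets x before its partner. *)
Definition opener D x : bool := rank x < rank (D x).

Lemma closerE D x : ~~ opener D x = (rank (D x) < rank x).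
Proof.
rewrite /opener; have := partner_neq D x; rewrite -(inj_eq rank_inj); lia.
Qed.

Lemma opener_partner D x : opener D (D x) = ~~ opener D x.
Proof. by rewrite closerE /opener partnerK. Qed.

(** A planar matching is a well-formed bracketing, hence determined by its opening
    brackets. If two of them first differ at the closing bracket y, let the
    partner z of y in one be to the right of its partner in the other: in
    the latter z is opened inside the chord ending at y, so it is closed before y,
    by a bracket on which both already agree; but in the former it is y that
    closes z. *)
Lemma opener_inj A B : opener A =1 opener B -> A = B.
Proof.
suff le A' B' y : opener A' =1 opener B' ->
    (forall z, rank z < rank y -> ~~ opener A' z -> A' z = B' z) ->
    ~~ opener A' y -> rank (A' y) <= rank (B' y).
  move=> eAB; have cl y : ~~ opener A y -> A y = B y.
    have [m] := ubnP (rank y); elim: m y => // m IH y lty hy.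
    have IHy z : rank z < rank y -> ~~ opener A z -> A z = B z.
      by move=> hz; apply: IH; apply: leq_trans hz _.
    apply: rank_inj; apply/eqP; rewrite eqn_leq (le A B) // (le B A) //.
    - by move=> z hz; rewrite -eAB => /(IHy z hz).
    - by rewrite -eAB.
  apply: val_inj; apply/ffunP=> x /=; have [hx|/cl//] := boolP (opener A x).
  have /cl h : ~~ opener A (A x) by rewrite opener_partner negbK.
  by rewrite -[LHS](partnerK B) -h partnerK.
move=> eAB IH hy; rewrite leqNgt; apply/negP=> lt.
set z := A' y; have hz : opener A' z by rewrite opener_partner.
have hz' := hz; rewrite eAB in hz'.
have hyB : ~~ opener B' y by rewrite -eAB.
have nz : z != B' y by apply: contraTneq lt => <-; rewrite ltnn.
have nzy : z != y by exact: partner_neq.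
have nz2 : B' z != y by apply: contra_neq nz => <-; rewrite partnerK.
have lBz : rank (B' z) < rank y.
  have := partner_planar nzy nz; rewrite /separates.
  move: hz' hyB nz2 lt hy; rewrite /opener -/z !closerE -(inj_eq rank_inj) -/z; lia.
have h : ~~ opener A' (B' z) by rewrite eAB opener_partner negbK.
have E := IH _ lBz h; rewrite partnerK in E.
by case/eqP: nz2; rewrite -[LHS](partnerK A') E partnerK.
Qed.

(** Stacking e_i on top of D joins the two partners of the top vertices i and
    i + 1, and puts a new link between these vertices. *)
Variables (i : nat) (hi : i.+1 < n).
Let t0 : vertex n := (true, Ordinal (ltnW hi)).
Let t1 : vertex n := (true, Ordinal hi).

Definition cap_fun D : {ffun vertex n -> vertex n} :=
  [ffun x => if x == t0 then t1 else if x == t1 then t0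
             else if x == D t0 then D t1 else if x == D t1 then D t0 else D x].

Let t1_neq_t0 : t1 != t0.
Proof. by rewrite xpair_eqE -val_eqE /= -[X in _ == X]addn0 -addn1 eqn_add2l. Qed.

Let rank_t : rank t0 = (rank t1).+1.
Proof. rewrite /rank /=; lia. Qed.

Variable D : diagram n.
Hypothesis D_t : D t0 != t1.

Let Dinj := inv_inj (@partnerK D).
Let D_t' : D t1 != t0.
Proof. by apply: contra_neq D_t => <-; rewrite partnerK. Qed.

Variant cap_spec x : vertex n -> Prop :=
  | CapT0 of x = t0 : cap_spec x t1
  | CapT1 of x = t1 : cap_spec x t0
  | CapD0 of x = D t0 & x != t0 & x != t1 : cap_spec x (D t1)
  | CapD1 of x = D t1 & x != t0 & x != t1 : cap_spec x (D t0)
  | CapOther of x != t0 & x != t1 & x != D t0 & x != D t1 : cap_spec x (D x).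

Lemma cap_funP x : cap_spec x (cap_fun D x).
Proof.
rewrite ffunE; case: eqVneq => [->|n0]; first by constructor.
case: eqVneq => [->|n1]; first by constructor.
case: eqVneq => [h|n2]; first by constructor.
by case: eqVneq => [h|n3]; constructor.
Qed.

Lemma cap_fun_t0 : cap_fun D t0 = t1. Proof. by rewrite ffunE eqxx. Qed.
Lemma cap_fun_t1 : cap_fun D t1 = t0.
Proof. by rewrite ffunE (negbTE t1_neq_t0) eqxx. Qed.
Lemma cap_fun_D0 : cap_fun D (D t0) = D t1.
Proof. by rewrite ffunE (negbTE (partner_neq _ _)) (negbTE D_t) eqxx. Qed.
Lemma cap_fun_D1 : cap_fun D (D t1) = D t0.
Proof.
rewrite ffunE (negbTE D_t') (negbTE (partner_neq _ _)) (inj_eq Dinj).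
by rewrite (negbTE t1_neq_t0) eqxx.
Qed.
Lemma cap_fun_other x : x != t0 -> x != t1 -> x != D t0 -> x != D t1 -> cap_fun D x = D x.
Proof. by rewrite ffunE; do 4 move/negbTE->. Qed.

Lemma cap_funK : involutive (cap_fun D).
Proof.
move=> x; case: (cap_funP x) => [->|->|-> _ _|-> _ _|n0 n1 n2 n3].
- exact: cap_fun_t1.
- exact: cap_fun_t0.
- exact: cap_fun_D1.
- exact: cap_fun_D0.
rewrite cap_fun_other ?partnerK ?(inj_eq Dinj) //.
  by apply: contra_neq n2 => <-; rewrite partnerK.
by apply: contra_neq n3 => <-; rewrite partnerK.
Qed.

(** Since t0 and t1 are neighbours, no other chord separates them; so a chord
    separates D t0 from D t1 no more than it separates t0 from t1, and
    symmetrically by additivity of separation. *)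
Lemma cap_is_diagram : is_diagram (cap_fun D).
Proof.
have fN x : cap_fun D x != x.
  case: (cap_funP x) => [->//|->|->_ _|-> _ _|_ _ _ _]; last exact: partner_neq.
  - by rewrite eq_sym.
  - by rewrite (inj_eq Dinj).
  - by rewrite (inj_eq Dinj) eq_sym.
apply: planar_is_diagram => // [|x y]; first exact: cap_funK.
have out z : z != t0 -> z != t1 -> cap_fun D z != t0 /\ cap_fun D z != t1.
  move=> n0 n1; split; [apply: contra_neq n1|apply: contra_neq n0] => h.
    by rewrite -[z]cap_funK h cap_fun_t0.
  by rewrite -[z]cap_funK h cap_fun_t1.
have adj z : z != t0 -> z != t1 -> (rank z < rank t1) = (rank z < rank t0).
  by rewrite -!(inj_eq rank_inj) rank_t; move: (rank z) (rank t1) => *; lia.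
have adj' z : z != t0 -> z != t1 -> (rank t1 < rank z) = (rank t0 < rank z).
  by rewrite -!(inj_eq rank_inj) rank_t; move: (rank z) (rank t1) => *; lia.
have [/orP xt|] := boolP ((x == t0) || (x == t1)).
  move=> nx nfx.
  have [y0 y1] : y != t0 /\ y != t1.
    by case: xt nx nfx => /eqP-> ; rewrite ?cap_fun_t0 ?cap_fun_t1.
  have [z0 z1] := out _ y0 y1; rewrite /separates.
  by case: xt => /eqP->; rewrite ?cap_fun_t0 ?cap_fun_t1 !adj' ?addbb.
rewrite negb_or => /andP[x0 x1] nx nfx; have [z0 z1] := out _ x0 x1.
have [/orP yt|] := boolP ((y == t0) || (y == t1)).
  suff E : separates (cap_fun D) x t0 = separates (cap_fun D) x t1.
    by case: yt => /eqP->; rewrite ?cap_fun_t0 ?cap_fun_t1.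
  by rewrite /separates !adj.
rewrite negb_or => /andP[y0 y1].
have pl0 := partner_planar (_ : y != t0) (_ : y != D t0).
have pl1 := partner_planar (_ : y != t1) (_ : y != D t1).
have DK z z' : z != D z' -> D z != z'.
  by apply: contra_neq => <-; rewrite partnerK.
rewrite /separates in pl0 pl1 *.
case: (cap_funP x) nx nfx => [ex|ex|ex _ _|ex _ _|_ _ x2 x3] nx nfx.
- by case/eqP: x0.
- by case/eqP: x1.
- case: (cap_funP y) => [ey|ey|ey _ _|ey _ _|_ _ y2 y3].
  + by case/eqP: y0.
  + by case/eqP: y1.
  + by case/eqP: nx; rewrite ex ey.
  + by case/eqP: nfx; rewrite ey.
  have := (pl0 y0 y2, pl1 y1 y3).
  rewrite ex (adj' y) // (adj' (D y)) ?DK // => -[].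
  by do 6!case: (_ < _).
- case: (cap_funP y) => [ey|ey|ey _ _|ey _ _|_ _ y2 y3].
  + by case/eqP: y0.
  + by case/eqP: y1.
  + by case/eqP: nfx; rewrite ey.
  + by case/eqP: nx; rewrite ex ey.
  have := (pl0 y0 y2, pl1 y1 y3).
  rewrite ex (adj' y) // (adj' (D y)) ?DK // => -[].
  by do 6!case: (_ < _).
have E0 : separates D x t0 = separates D x (D t0).
  by apply: partner_planar; rewrite eq_sym ?DK.
have E1 : separates D x t1 = separates D x (D t1).
  by apply: partner_planar; rewrite eq_sym ?DK.
case: (cap_funP y) => [ey|ey|ey _ _|ey _ _|_ _ y2 y3].
- by case/eqP: y0.
- by case/eqP: y1.
- move: E0 E1; rewrite /separates ey (adj x) // (adj (D x)) ?DK // => <-; exact.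
- move: E0 E1; rewrite /separates ey (adj x) // (adj (D x)) ?DK // => <- <-; exact.
exact: partner_planar.
Qed.

Definition cap : diagram n := Diagram cap_is_diagram.

(** When t1 closes a link of D, the only vertex other than t0 and t1 that can turn
    from opening to closing is the partner of t1: this happens when t0 closes its
    link as well, so that the links of t0 and t1 are nested and D t0 comes before
    D t1. *)
Lemma cap_opener x : ~~ opener D t1 ->
  opener cap x = if x == t0 then false else if x == t1 then true
                 else opener D x && (opener D t0 || (x != D t1)).
Proof.
move=> c1; have o1 : opener D (D t1) by rewrite opener_partner.
rewrite /opener /=; case: (cap_funP x) => [->|->|-> x0 x1|-> x0 x1|x0 x1 x2 x3].
- by rewrite eqxx rank_t; apply/negbTE; rewrite -leqNgt.
- by rewrite (negbTE t1_neq_t0) eqxx rank_t leqnn.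
- rewrite (negbTE x0) (negbTE x1) (inj_eq Dinj) eq_sym t1_neq_t0 orbT andbT partnerK.
  have n1 : t1 != D t0 by rewrite eq_sym.
  have := partner_planar t1_neq_t0 n1; rewrite /separates rank_t.
  move: c1 D_t (partner_neq D t0); rewrite closerE -!(inj_eq rank_inj) rank_t.
  move: (rank t1) (rank (D t0)) (rank (D t1)) => a b c *; lia.
- rewrite (negbTE x0) (negbTE x1) eqxx orbF partnerK.
  have n1 : t1 != D t0 by rewrite eq_sym.
  have := partner_planar t1_neq_t0 n1; rewrite /separates rank_t.
  move: c1 D_t (partner_neq D t0); rewrite closerE -!(inj_eq rank_inj) rank_t.
  move: (rank t1) (rank (D t0)) (rank (D t1)) => a b c *; lia.
by rewrite (negbTE x0) (negbTE x1) x3 orbT andbT.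
Qed.

Let E := e_diagram hi.
Let R := stack_edge E D.

Let e_t0 b : E (b, t0.2) = (b, t1.2). Proof. by rewrite /= ffunE /= eqxx. Qed.
Let e_t1 b : E (b, t1.2) = (b, t0.2).
Proof.
rewrite /= ffunE /= eqxx; case: eqP => // h.
by have := t1_neq_t0; rewrite /t1 h eqxx.
Qed.
Let e_other b j : j != t0.2 -> j != t1.2 -> E (b, j) = (~~ b, j).
Proof. by move=> /negbTE n0 /negbTE n1; rewrite /= ffunE /= n0 n1. Qed.

Let RD x : R (lower x) (lower (D x)).
Proof. by apply/orP; left; apply/existsP; exists x; rewrite !eqxx. Qed.
Let RE x : R (upper x) (upper (E x)).
Proof. by apply/orP; right; apply/existsP; exists x; rewrite !eqxx. Qed.

Let R_sym : symmetric R.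
Proof.
have sub s s' : R s s' -> R s' s.
  case/orP=> /existsP[u /andP[/eqP-> /eqP->]].
    by rewrite -{2}[u](partnerK D) RD.
  by rewrite -{2}[u](partnerK E) RE.
by move=> s s'; apply/idP/idP; apply: sub.
Qed.

Let conn_sym : connect_sym R.
Proof. exact: sym_connect_sym. Qed.

Let ends (x : vertex n) : {set vertex n} := [set x; cap x].

(** The outer ends of the component of a point: an explicit invariant of the
   edges of the stack, which bounds the connected components from above. *)
Let component (s : stack_point n) : {set vertex n} :=
  match s with
  | inl x => ends x
  | inr j => if (j == t0.2) || (j == t1.2) then ends (D t0) else ends (true, j)
  end.

Let ends_cap x : ends (cap x) = ends x.
Proof. by rewrite /ends /= cap_funK setUC. Qed.

Let component_edge s s' : R s s' -> component s = component s'.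
Proof.
have lowD u : component (lower u) =
    if (u == t0) || (u == t1) then ends (D t0) else ends u.
  by case: u => [[] j].
case/orP=> /existsP[u /andP[/eqP-> /eqP->]].
  rewrite !lowD; case: (altP (u =P t0)) => [->|u0] /=.
    by rewrite (negbTE (partner_neq _ _)) (negbTE D_t).
  case: (altP (u =P t1)) => [->|u1] /=.
    rewrite (negbTE (partner_neq _ _)) (negbTE D_t') /=.
    by rewrite -[D t1]cap_fun_D0 ends_cap.
  case: (altP (D u =P t0)) => [<-|du0] /=; first by rewrite partnerK.
  case: (altP (D u =P t1)) => [du1|du1] /=.
    have -> : u = D t1 by rewrite -du1 partnerK.
    by rewrite -[D t1]cap_fun_D0 ends_cap.
  rewrite -ends_cap /= cap_fun_other //.
    by apply: contra_neq du0 => ->; rewrite partnerK.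
  by apply: contra_neq du1 => ->; rewrite partnerK.
case: u => b j; case: (altP (j =P t0.2)) => [->|j0].
  rewrite e_t0; case: b; rewrite /upper /= ?eqxx ?orbT //=.
  by rewrite -[ends t0]ends_cap /= cap_fun_t0.
case: (altP (j =P t1.2)) => [->|j1].
  rewrite e_t1; case: b; rewrite /upper /= ?eqxx ?orbT //=.
  by rewrite -[ends t0]ends_cap /= cap_fun_t0.
by rewrite e_other //; case: b; rewrite /upper /= (negbTE j0) (negbTE j1).
Qed.

Let component_connect s s' : connect R s s' -> component s = component s'.
Proof.
case/connectP=> p; elim: p s => [|z p IH] s /=; first by move=> _ ->.
by case/andP=> /component_edge-> /IH h /h.
Qed.

Let conn_up j : j != t0.2 -> j != t1.2 -> connect R (inr j) (inl (true, j)).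
Proof. by move=> j0 j1; apply: connect1; have := RE (false, j); rewrite e_other. Qed.

Let conn_low x : x != t0 -> x != t1 -> connect R (lower x) (inl x).
Proof. by case: x => [[] j] x0 x1 //; apply: conn_up. Qed.

Let conn_cap x : connect R (inl x) (inl (cap x)).
Proof.
have D01 : connect R (inl (D t0)) (inl (D t1)).
  apply: connect_trans (_ : connect R _ (lower (D t0))) _.
    by rewrite conn_sym conn_low ?partner_neq.
  apply: connect_trans (_ : connect R _ (lower (D t1))) _; last first.
    exact: conn_low (D_t') (partner_neq _ _).
  rewrite conn_sym; apply: connect_trans (connect1 (RD (D t1))) _.
  apply: connect_trans (_ : connect R _ (lower t0)) (connect1 (RD t0)).
  by rewrite partnerK; apply: connect1; have := RE (false, t1.2); rewrite e_t1.
case: (cap_funP x) => [->|->|-> _ _|-> _ _|x0 x1 x2 x3] //.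
- by apply: connect1; have := RE t0; rewrite e_t0.
- by apply: connect1; have := RE t1; rewrite e_t1.
- by rewrite conn_sym.
apply: connect_trans (_ : connect R _ (lower x)) _; first by rewrite conn_sym conn_low.
apply: connect_trans (connect1 (RD x)) (conn_low _ _).
  by apply: contra_neq x2 => <-; rewrite partnerK.
by apply: contra_neq x3 => <-; rewrite partnerK.
Qed.

Lemma cap_is_stack : is_stack (e_diagram hi) D cap.
Proof.
apply/forallP=> x; apply/forallP=> y; apply/eqP; apply/idP/andP.
  by move/eqP=> <-; rewrite eq_sym (partner_neq cap) conn_cap.
case=> xy /component_connect/= h; have : y \in ends x by rewrite h set21.
by rewrite !inE eq_sym (negbTE xy) eq_sym.
Qed.

(** The middle vertices i and i + 1 are not joined by D, so they lead out of the
    middle line through D, all the others through the vertical links of e_i. *)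
Lemma cap_loops : loops (e_diagram hi) D = 0.
Proof.
have out (s : stack_point n) : exists y : vertex n, connect R s (inl y).
  case: s => [x|j]; first by exists x.
  have [[->]|n0] := eqVneq (true, j) t0.
    exists (D t0); apply: connect_trans (connect1 (RD t0)) _.
    exact: conn_low (partner_neq D t0) D_t.
  have [[->]|n1] := eqVneq (true, j) t1.
    exists (D t1); apply: connect_trans (connect1 (RD t1)) _.
    exact: conn_low D_t' (partner_neq D t1).
  by exists (true, j); apply: conn_low.
apply: eq_card0 => s; rewrite !inE; apply/negbTE/negP=> /andP[_ /forallP h].
by have [y] := out s; rewrite (negbTE (h y)).
Qed.

End Diagrams.

Lemma is_stack_inj n (D' D A B : diagram n) : is_stack D' D A -> is_stack D' D B -> A = B.
Proof.
move=> /forallP hA /forallP hB; apply: val_inj; apply/ffunP=> x /=.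
have /forallP/(_ (A x))/eqP := hA x; have /forallP/(_ (A x))/eqP := hB x.
by rewrite eqxx => <- /esym/eqP.
Qed.

(** * The diagram of a word *)

Lemma index_filter_iota (P : pred nat) n x : x \in [seq j <- iota 0 n | P j] ->
  index x [seq j <- iota 0 n | P j] = count P (iota 0 x).
Proof.
rewrite mem_filter mem_iota => /andP[Px hx].
have -> : iota 0 n = iota 0 x ++ x :: iota x.+1 (n - x.+1).
  by rewrite -[n in LHS](subnKC (ltnW hx)) iotaD add0n -(subnSK hx).
rewrite filter_cat index_cat /= Px /= eqxx addn0 size_filter.
by rewrite mem_filter mem_iota add0n ltnn !andbF.
Qed.

(** The i-th free bottom vertex is joined to the i-th free top vertex: in terms of
    positions, both have the same number of free vertices on their left. *)
Lemma zip_filter_iota (P Q : pred nat) n x y :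
  (x, y) \in zip [seq j <- iota 0 n | P j] [seq j <- iota 0 n | Q j] ->
  [/\ P x, Q y & count P (iota 0 x) = count Q (iota 0 y)].
Proof.
set s := filter P _; set t := filter Q _.
case/(nthP (0, 0))=> m; rewrite size_zip leq_min => /andP[hs ht].
rewrite nth_zip_cond size_zip leq_min hs ht /= => -[ex ey].
have xs : x \in s by rewrite -ex mem_nth.
have yt : y \in t by rewrite -ey mem_nth.
have [us ut] : uniq s /\ uniq t by rewrite !filter_uniq ?iota_uniq.
have := xs; have := yt; rewrite !mem_filter => /andP[-> _] /andP[-> _]; split=> //.
by rewrite -!(@index_filter_iota _ n) // -/s -/t -ex -ey !index_uniq.
Qed.

Lemma count_outside_iota a c m : a <= c ->
  count (fun j => ~~ (a <= j < c)) (iota 0 m) = minn m a + (m - c).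
Proof.
move=> ac; elim: m => [|m IH]; first by rewrite min0n.
by rewrite -addn1 iotaD count_cat IH /=; lia.
Qed.

Lemma size_top_links w : size (top_links w) = count (matched_minus w) (iota 0 (size w)).
Proof.
have TP := top_linksP w.
rewrite -size_filter -(size_map snd); apply: perm_size; apply: uniq_perm.
- by have := ti_uniq TP; rewrite cat_uniq => /and3P[].
- by rewrite filter_uniq ?iota_uniq.
move=> d; rewrite mem_filter mem_iota add0n /=; apply/mapP/andP.
  case=> -[c d'] /= h ->; have [_ _ ld _ wd] := ti_rng TP h.
  by rewrite ld /matched_minus wd; split=> //; apply/is_linkedP; exists c; right.
case=> /andP[/eqP wd /is_linkedP[c [h|h]]] ld; last by exists (c, d).
by have [_ _ _ + _] := ti_rng TP h; rewrite (set_nth_default vp) ?wd.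
Qed.

Lemma size_top_links_le w : size (top_links w) <= count_mem vm w.
Proof.
have TP := top_linksP w; rewrite -(size_map snd); apply: (@uniq_positions _ vp).
  by have := ti_uniq TP; rewrite cat_uniq => /and3P[].
by move=> d /mapP[[c d'] h -> /=]; case: (ti_rng TP h).
Qed.

Lemma bottom_linked k p a : p <= k ->
  is_linked (bottom_links k p) a = (k - p <= a < k + p).
Proof.
move=> pk; apply/is_linkedP/idP => [[b []/mapP[m]]|h].
- by rewrite mem_iota => hi [-> _]; lia.
- by rewrite mem_iota => hi [_ ->]; lia.
case: (ltnP a k) => hk.
  exists (k + (k - a.+1)); left; apply/mapP; exists (k - a.+1).
    by rewrite mem_iota; lia.
  by congr (_, _); lia.
exists (k - (a - k).+1); right; apply/mapP; exists (a - k).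
  by rewrite mem_iota; lia.
by congr (_, _); lia.
Qed.

Section Partners.
Variables (n : nat) (w : n.-tuple bool).
Let T := top_links w.
Let k := count_mem vm w.
Let p := size T.
Let B := bottom_links k p.
Let D := d_diagram w.

Variant linked_spec (x : vertex n) : vertex n -> Prop :=
  | TopLeft (c d : 'I_n) of x = (true, c) & (val c, val d) \in T : linked_spec x (true, d)
  | TopRight (c d : 'I_n) of x = (true, d) & (val c, val d) \in T :
      linked_spec x (true, c)
  | BottomLeft (c d : 'I_n) i of x = (false, c) & i < p &
      c = k - i.+1 :> nat & d = k + i :> nat :
      linked_spec x (false, d)
  | BottomRight (c d : 'I_n) i of x = (false, d) & i < p &
      c = k - i.+1 :> nat & d = k + i :> nat :
      linked_spec x (false, c)
  | ThroughBottom (c d : 'I_n) of x = (false, c) &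
      (val c, val d) \in through_links n B T : linked_spec x (true, d)
  | ThroughTop (c d : 'I_n) of x = (true, d) &
      (val c, val d) \in through_links n B T : linked_spec x (false, c).

Lemma d_diagramP x : linked_spec x (D x).
Proof.
have : d_linked w x (D x).
  have := partner_neq D x; rewrite /D /= /d_fun ffunE.
  by case: pickP => [//|_] /=; rewrite eqxx.
move: (D x) => y; rewrite /d_linked /d_links size_tuple !mem_cat -/T -/k -/p -/B.
case: x y => [b1 c] [b2 d] /=.
case/orP=> /or3P[]/mapP[[c' d'] h /= [-> E1 -> E2]]; rewrite -E1 -E2 in h.
- exact: TopLeft h.
- by case/mapP: h => i; rewrite mem_iota => /andP[_ hi] [ec ed]; apply: BottomLeft ec ed.
- exact: ThroughBottom h.
- exact: TopRight h.
- by case/mapP: h => i; rewrite mem_iota => /andP[_ hi] [ec ed]; apply: BottomRight ec ed.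
- exact: ThroughTop h.
Qed.

Let p_le_k : p <= k := size_top_links_le w.

Lemma through_links_unlinked c d : (c, d) \in through_links n B T ->
  [/\ ~~ is_linked B c, ~~ is_linked T d
    & count (fun a => ~~ is_linked B a) (iota 0 c) =
      count (fun a => ~~ is_linked T a) (iota 0 d)].
Proof. exact: zip_filter_iota. Qed.

(** The p nested bottom links close at k, ..., k + p - 1, and through links open
    at the bottom; the top line is traversed from right to left, so a linked -
    opens and every other top vertex closes. *)
Lemma d_opener x : opener D x =
  if x.1 then matched_minus w x.2 else ~~ (k <= x.2 < k + p).
Proof.
rewrite /opener; case: (d_diagramP x) => [c d|c d|c d i|c d i|c d|c d] ->;
  rewrite /rank /=; have := ltn_ord c; have := ltn_ord d.
- move=> _ ld; case/(ti_rng (top_linksP w)) => _ lcd _ wc _.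
  rewrite /matched_minus (set_nth_default vm) ?wc ?size_tuple //=; lia.
- move=> _ ld cd; case/(ti_rng (top_linksP w)): (cd) => _ lcd _ _ wd.
  rewrite /matched_minus wd /=.
  have -> : is_linked (top_links w) d by apply/is_linkedP; exists (val c); right.
  lia.
- by move: p_le_k => pk _ _ hi -> -> /=; lia.
- by move: p_le_k => pk _ _ hi -> -> /=; lia.
- move=> ld lc /through_links_unlinked[+ _ _].
  by rewrite bottom_linked //; move: p_le_k => pk /=; lia.
- move=> ld lc /through_links_unlinked[_ /negbTE h _].
  by rewrite /matched_minus h andbF /=; lia.
Qed.

Lemma top_link_partner (c d : 'I_n) :
  ((val c, val d) \in T) = (D (true, d) == (true, c)) && (c < d).
Proof.
have TP := top_linksP w; apply/idP/andP.
  move=> cd; split; last by case: (ti_rng TP cd).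
  have [_ lcd _ wc wd] := ti_rng TP cd.
  case: (d_diagramP (true, d)) => // [c' d'|c' d'|c' d'] [ed] h.
  - have [_ _ _ + _] := ti_rng TP h.
    by rewrite -ed (set_nth_default vp) ?wd ?size_tuple ?ltn_ord.
  - by rewrite -ed in h; rewrite (val_inj (matching_snd (ti_uniq TP) cd h)).
  - have [_ + _] := through_links_unlinked h; rewrite -ed => /negP[].
    by apply/is_linkedP; exists (val c); right.
case=> /eqP + lcd; case: (d_diagramP (true, d)) => // [c' d'|c' d'] [ed] h [ec].
  by have [_ lt _ _ _] := ti_rng TP h; rewrite -ed ec ltnNge ltnW in lt.
by rewrite ed -ec.
Qed.

Lemma through_link_partner (c d : 'I_n) :
  D (true, d) = (false, c) -> (val c, val d) \in through_links n B T.
Proof. by case: (d_diagramP (true, d)) => // c' d' [->] h [<-]. Qed.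

End Partners.

Lemma count_letter (b : bool) (w : seq bool) :
  count_mem b w = count (fun y => nth vp w y == b) (iota 0 (size w)).
Proof. by rewrite -[in LHS](mkseq_nth vp w) /mkseq count_map. Qed.

Section Swap.
Variables (n : nat) (u v : seq bool) (w w' : n.-tuple bool).
Hypotheses (Ew : w = u ++ [:: vp, vm & v] :> seq bool)
  (Ew' : w' = u ++ [:: vm, vp & v] :> seq bool).
Let i := size u.
Hypothesis hi : i.+1 < n.
Let t0 : vertex n := (true, Ordinal (ltnW hi)).
Let t1 : vertex n := (true, Ordinal hi).
Let D := d_diagram w'.
Let k := count_mem vm w'.
Let p := size (top_links w).
Let p' := size (top_links w').

Let k_eq : count_mem vm w = k.
Proof. by rewrite /k Ew Ew' !count_cat /=; lia. Qed.

Let m_t0 : matched_minus w i = false.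
Proof. by rewrite Ew; case: (matched_swap_pair u v). Qed.
Let m_t1 : matched_minus w i.+1 = true.
Proof. by rewrite Ew; case: (matched_swap_pair u v). Qed.
Let m'_t1 : matched_minus w' i.+1 = false.
Proof. by rewrite Ew'; case: (matched_swap_pair u v). Qed.
Let m_other x : x != i -> x != i.+1 -> matched_minus w x =
  matched_minus w' x && (matched_minus w' i || ((i.+1, x) \notin top_links w')).
Proof. by rewrite Ew Ew'; apply: matched_swap. Qed.

(** The vertex t1 carries a +, so its partner precedes it on the way around the
    strip, whereas t0 follows it. *)
Lemma swap_uncapped : D t0 != t1.
Proof.
have c1 : opener D t1 = false by rewrite d_opener.
apply/eqP=> E; have := opener_partner D t0; rewrite E c1 => /esym/negbFE.
by rewrite /opener E /rank /=; lia.
Qed.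

Let w'_t0 x0 : nth x0 w' i = vm.
Proof. by rewrite Ew'; case: (nth_pair u x0 vm vp v). Qed.
Let w'_t1 x0 : nth x0 w' i.+1 = vp.
Proof. by rewrite Ew'; case: (nth_pair u x0 vm vp v). Qed.

Let Mset (s : seq bool) : {set 'I_n} := [set j : 'I_n | matched_minus s j].

Let size_Mset (s : n.-tuple bool) : size (top_links s) = #|Mset s|.
Proof.
rewrite size_top_links size_tuple -val_enum_ord count_map.
by rewrite -sum1_count big_enum_cond -sum1dep_card; apply: eq_bigl.
Qed.

(** If the - at i is linked in w', it passes its partner on to the - at i + 1. *)
Let p_same : matched_minus w' i -> p = p'.
Proof.
move=> m0; rewrite /p /p' !size_Mset.
have -> : Mset w = t1.2 |: (Mset w' :\ t0.2).
  apply/setP=> j; rewrite !inE -!val_eqE /=.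
  have [->|n1] := eqVneq (j : nat) i.+1; first by rewrite m_t1.
  have [->|n0] := eqVneq (j : nat) i; first by rewrite m_t0.
  by rewrite m_other // m0 andbT.
rewrite cardsU1 !inE -val_eqE /= m'_t1 andbF /= (cardsD1 t0.2 (Mset w')).
by rewrite inE m0.
Qed.

Let closer_t1 : ~~ opener D t1. Proof. by rewrite d_opener /= m'_t1. Qed.

Let linked_t1 (b : 'I_n) : ((i.+1, val b) \in top_links w') = (D t1 == (true, b)).
Proof.
have -> : ((i.+1, val b) \in top_links w') = (D (true, b) == t1) && (i.+1 < b).
  exact: top_link_partner w' t1.2 b.
apply/andP/eqP=> [[/eqP h _]|h]; first by rewrite -[RHS](partnerK D) h.
split; first by rewrite -h partnerK.
have := closer_t1; rewrite closerE h /rank /=; move: (ltn_ord b) => ?; lia.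
Qed.

(** If the - at i is free but the + at i + 1 is linked with b, then b is set free and
   replaced by the - at i + 1. *)
Let p_displaced (b : 'I_n) : ~~ matched_minus w' i -> D t1 = (true, b) -> p = p'.
Proof.
move=> /negbTE m0 Db; rewrite /p /p' !size_Mset.
have mb : matched_minus w' b.
  by have := opener_partner D t1; rewrite Db closer_t1 d_opener.
have -> : Mset w = t1.2 |: (Mset w' :\ b).
  apply/setP=> j; rewrite !inE -[j == t1.2]val_eqE /=.
  have [->|n1] := eqVneq (j : nat) i.+1; first by rewrite m_t1.
  have [ji|n0] := eqVneq (j : nat) i; first by rewrite ji m_t0 m0 andbF.
  by rewrite m_other // m0 linked_t1 Db xpair_eqE eqxx /= eq_sym andbC.
by rewrite cardsU1 !inE /= m'_t1 andbF (cardsD1 b (Mset w')) inE mb.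
Qed.

(** If both letters are free, a link is created at the top. The free - letters are
   exactly the k - p' free top vertices up to i, so i + 1 comes next and is joined to
   the first free bottom vertex to the right of the nested links. *)
Let p_new (b : 'I_n) : ~~ matched_minus w' i -> D t1 = (false, b) ->
  p = p'.+1 /\ b = k + p' :> nat.
Proof.
move=> m0 Db; split.
  rewrite /p /p' !size_Mset.
  have -> : Mset w = t1.2 |: Mset w'.
    apply/setP=> j; rewrite !inE -val_eqE /=.
    have [->|n1] := eqVneq (j : nat) i.+1; first by rewrite m_t1.
    have [->|n0] := eqVneq (j : nat) i; first by rewrite m_t0 (negbTE m0).
    by rewrite m_other // (negbTE m0) linked_t1 Db andbT.
  by rewrite cardsU1 inE /= m'_t1.
have TP := top_linksP w'; have pk := size_top_links_le w'; rewrite -/k -/p' in pk.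
set P := fun a => ~~ is_linked (top_links w') a.
have [b_out t1_free] : [/\ ~~ is_linked (bottom_links k p') b, P i.+1
    & count (fun a => ~~ is_linked (bottom_links k p') a) (iota 0 b) =
      count P (iota 0 i.+1)].
  exact: through_links_unlinked (through_link_partner Db).
rewrite (eq_count (fun a => congr1 negb (bottom_linked a pk))).
rewrite bottom_linked // in b_out.
have En : iota 0 n = iota 0 i.+1 ++ iota i.+1 (n - i.+1).
  by rewrite -[in LHS](subnKC (ltnW hi)) iotaD.
have -> : count P (iota 0 i.+1) = k - p'.
  have -> : count P (iota 0 i.+1) =
      count (fun y => P y && (nth vp w' y == vm)) (iota 0 n).
    rewrite En count_cat.
    rewrite [X in _ = _ + X](_ : _ = 0) ?addn0.
      apply: eq_in_count => y; rewrite mem_iota /= add0n ltnS => le.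
      have [Py|//] /= := boolP (P y); apply/esym/eqP.
      have [->|ni] := eqVneq y i; first exact: w'_t0.
      have lt : y < i by rewrite ltn_neqAle ni.
      have ltn : y < size w' by rewrite size_tuple; exact: ltn_trans lt (ltnW hi).
      rewrite (set_nth_default vm) //; apply/negbTE/negP=> wy.
      case/negP: m0; rewrite /matched_minus w'_t0 /=.
      apply: (ti_free TP (c := y)) => //; last by rewrite lt size_tuple (ltnW hi).
    apply/eqP; rewrite -leqn0 leqNgt -has_count; apply/hasPn=> y.
    rewrite mem_iota => hy; rewrite negb_and negbK.
    have [wy|_] := eqVneq (nth vp w' y) vm; rewrite /= ?orbT ?orbF //.
    apply: (ti_free TP (c := i.+1)) => //; rewrite size_tuple.
    have [E|n1] := eqVneq y i.+1; last by lia.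
    by move: wy; rewrite E w'_t1.
  have splitP s : count (fun y => nth vp w' y == vm) s =
      count (matched_minus w') s + count (fun y => P y && (nth vp w' y == vm)) s.
    elim: s => //= y s ->; rewrite /matched_minus /P.
    by case: (nth _ _ _ == _); case: is_linked => /=; lia.
  rewrite /k count_letter size_tuple splitP /p' size_top_links size_tuple.
  by rewrite addKn.
rewrite count_outside_iota; last by lia.
by move: b_out pk => /=; lia.
Qed.

(** Creating a descent +- at i amounts to multiplying by e_i. Both sides are planar
    matchings, so it suffices to compare their openers, case by case on what the
    letters of -+ are linked with. *)
Lemma d_diagram_swap : d_diagram w = cap swap_uncapped.
Proof.
apply: opener_inj => -[[] j]; rewrite cap_opener // -/t0 -/t1 d_opener.
  have -> : ((true, j) == t0) = (val j == i) by rewrite /t0 xpair_eqE -val_eqE.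
  have -> : ((true, j) == t1) = (val j == i.+1) by rewrite /t1 xpair_eqE -val_eqE.
  rewrite /=; have [->|n0] := eqVneq (j : nat) i; first by rewrite m_t0.
  have [->|n1] := eqVneq (j : nat) i.+1; first by rewrite m_t1.
  by rewrite m_other // !d_opener /= linked_t1 eq_sym.
have -> : ((false, j) == t0) = false by rewrite xpair_eqE.
have -> : ((false, j) == t1) = false by rewrite xpair_eqE.
rewrite !d_opener k_eq -/k -/p -/p' -/D /=.
have [m0|m0] := boolP (matched_minus w' i); first by rewrite p_same //= andbT.
case Db : (D t1) => [[] b]; rewrite ?(p_displaced m0 Db) ?andbT //.
have [-> eb] := p_new m0 Db; rewrite xpair_eqE -val_eqE /= eb.
by lia.
Qed.

End Swap.

(** Without descents nothing is linked on the top line. *)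
Lemma d_diagram_sorted n (w : n.-tuple bool) a b :
  w = nseq a vm ++ nseq b vp :> seq bool -> d_diagram w = id_diagram n.
Proof.
move=> Ew; have T0 : top_links w = [::].
  case E : (top_links w) => [//|[c d] L].
  have : (c, d) \in top_links w by rewrite E mem_head.
  case/(ti_rng (top_linksP w)) => _ lcd ld; rewrite Ew !nth_cat !nth_nseq !size_nseq.
  by case: (ltnP c a) => // ac _; case: (ltnP d a) => [|ad]; [lia|case: ifP].
apply: opener_inj => -[[] j]; rewrite d_opener T0 /opener /rank /= ffunE /=.
  by rewrite /matched_minus T0 andbF; have := ltn_ord j; lia.
by have := ltn_ord j; lia.
Qed.

(** * Coordinates of the heart product *)

Local Open Scope ring_scope.

Lemma sorted_or_descent (w : seq bool) :
  w = nseq (count_mem vm w) vm ++ nseq (size w - count_mem vm w) vp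
  \/ exists u v, w = u ++ [:: vp, vm & v].
Proof.
elim: w => [|b w [Ew|[u [v ->]]]]; first by left.
  case: b; last by left; rewrite {1}Ew /= subSS.
  case E : (count_mem vm w) Ew => [|a] Ew.
    by left; rewrite /= E {1}Ew !subn0.
  by right; exists [::], (nseq a vm ++ nseq (size w - a.+1) vp); rewrite {1}Ew.
by right; exists (b :: u), v.
Qed.

(** Bubble sort: each exchange of a descent +- removes one inversion. *)
Lemma word_ind (P : seq bool -> Prop) :
  (forall a b, P (nseq a vm ++ nseq b vp)) ->
  (forall u v, P (u ++ [:: vm, vp & v]) -> P (u ++ [:: vp, vm & v])) ->
  forall w, P w.
Proof.
move=> Psorted Pswap.
pose inv := fix inv (w : seq bool) : nat :=
  if w is b :: w' then (b * count_mem vm w' + inv w')%N else 0%N.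
have inv_swap u v : inv (u ++ [:: vp, vm & v]) = (inv (u ++ [:: vm, vp & v])).+1.
  elim: u => [|b u IH] /=; first by lia.
  by rewrite IH !count_cat /=; lia.
move=> w; have [m] := ubnP (inv w); elim: m w => // m IH w lt.
have [->//|[u [v E]]] := sorted_or_descent w.
by rewrite E; apply/Pswap/IH; rewrite E inv_swap in lt.
Qed.

Section Hearts.
Variables (F : fieldType) (q : F).

(** The coordinates of delta(1). *)
Definition cup (x y : bool) : F :=
  if x then (~~ y)%:R else if y then - q^-1 else 0.

(** The coordinate at t of the heart product of w, computed from left to right. The
    stack st holds the letters of t facing the + letters not yet linked: a -
    links with the last of them, if any. At the end the remaining + are free. *)
Fixpoint heart_coef (st w t : seq bool) : F :=
  match w, t with
  | [::], [::] => (all id st)%:R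
  | true :: w', x :: t' => heart_coef (x :: st) w' t'
  | false :: w', y :: t' =>
      if st is x :: st' then cup x y * heart_coef st' w' t'
      else (~~ y)%:R * heart_coef [::] w' t'
  | _, _ => 0
  end.

Lemma heart_coef_rcons st w t x : size w = size t ->
  heart_coef st (rcons w vp) (rcons t x) = heart_coef st w t * x%:R.
Proof.
elim: w t st => [|b w IH] [|y t] //= st; first by case: x; rewrite /= ?mulr1 ?mulr0.
move=> [sz]; case: b; first exact: IH.
by case: st => [|z st]; rewrite IH // mulrA.
Qed.

Lemma heart_coef_cup st u v s x y s' : size u = size s ->
  heart_coef st (u ++ [:: vp, vm & v]) (s ++ [:: x, y & s']) =
  cup x y * heart_coef st (u ++ v) (s ++ s').
Proof.
elim: u s st => [|b u IH] [|z s] //= st [sz].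
case: b; first exact: IH.
by case: st => [|z' st]; rewrite IH // mulrCA.
Qed.

(** A pending + with letter + at the bottom of the stack has no influence: if it
    stays free, + is the required letter, and if it is linked with a -, the link
    has weight 1 or 0 according as that - has letter - or +, as if it were free. *)
Lemma heart_coef_bottom st w t : heart_coef (rcons st vp) w t = heart_coef st w t.
Proof.
elim: w t st => [|b w IH] [|y t] st //=; first by rewrite all_rcons.
case: b; first by rewrite -rcons_cons IH.
by case: st => [|x st] //=; rewrite IH.
Qed.

Lemma heart_coef_sorted a b t :
  heart_coef [::] (nseq a vm ++ nseq b vp) t = (t == nseq a vm ++ nseq b vp)%:R.
Proof.
elim: a t => [|a IH] t /=.
  have H st : heart_coef st (nseq b vp) t = (all id st && (t == nseq b vp))%:R.
    elim: b t st => [|b IH] [|x t] st /=; rewrite ?andbT ?andbF //.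
    by rewrite IH /= eqseq_cons; case: x => //=; rewrite andbF.
  exact: H.
case: t => [|y t] //=; rewrite IH eqseq_cons.
by case: y; rewrite /= ?mul0r ?mul1r.
Qed.

Definition heart_tens n (w : seq bool) : tens F n :=
  [ffun t : n.-tuple bool => heart_coef [::] w t].

Lemma coef_tuple n (x : tens F n) (t : n.-tuple bool) : coef x t = x t.
Proof. by rewrite /coef valK. Qed.

Lemma coef_ffun n (f : seq bool -> F) (s : seq bool) : size s = n ->
  coef ([ffun t : n.-tuple bool => f t] : tens F n) s = f s.
Proof. by move/eqP=> hs; rewrite -[s]/(tval (Tuple hs)) coef_tuple ffunE. Qed.

Lemma coef_basis n (s s' : seq bool) : size s' = n ->
  coef (basis F n s) s' = (s' == s)%:R.
Proof. exact: (coef_ffun (fun r => (r == s)%:R)). Qed.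

Lemma tuple_split n (t : n.-tuple bool) a : (a.+1 < n)%N ->
  exists s x y s', [/\ tval t = s ++ [:: x, y & s'], size s = a & (a.+2 + size s')%N = n].
Proof.
move=> lt; have st := size_tuple t; have lt' := ltnW lt.
exists (take a t), (nth vm t a), (nth vm t a.+1), (drop a.+2 t).
rewrite size_drop size_takel st ?subnKC //; last exact: ltnW.
by split=> //; rewrite -!drop_nth ?st // cat_take_drop.
Qed.

Lemma drop_pair (T : Type) a (s s' : seq T) x y : size s = a ->
  drop (a + 2) (s ++ [:: x, y & s']) = s'.
Proof. by move=> <-; rewrite drop_cat ltnNge leq_addr /= addKn /= drop0. Qed.

Lemma deltaE (z : tens F 0) x y : coef (delta q z) [:: x; y] = coef z [::] * cup x y.
Proof.
rewrite -[[:: x; y]]/(tval [tuple x; y]) coef_tuple !ffunE.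
by case: x; case: y; rewrite /GRing.scale /= ?mulr0 ?mulr1 ?subr0 ?sub0r ?mulr1 ?mulr0.
Qed.

Lemma epsilonE (x : tens F 2) :
  coef (epsilon q x) [::] = - q * coef x [:: vp; vm] + coef x [:: vm; vp].
Proof. by rewrite -[[::]]/(tval [tuple]) coef_tuple ffunE. Qed.

(** All derivations from w lead to the same vector, because heart_coef obeys each
    of the three rules. *)
Lemma heartP n (w : seq bool) (x : tens F n) : heart q w x ->
  size w = n /\ x = heart_tens n w.
Proof.
elim=> {n w x} [|n w x _ [sw ->]|n w x _ [sw ->]|n w1 w2 x _ [sw ->]].
- by split=> //; apply/ffunP=> t; rewrite !ffunE tuple0.
- split; first by rewrite /= sw.
  apply/ffunP=> t; case/tupleP: t => y t; rewrite !ffunE /= drop0 take0.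
  by rewrite coef_basis // coef_ffun ?size_tuple //; case: y.
- split; first by rewrite size_rcons sw.
  apply/ffunP=> t; rewrite !ffunE; have := size_tuple t.
  case/lastP: (tval t) => // s y; rewrite size_rcons => -[ss].
  rewrite heart_coef_rcons ?sw // -cats1 take_size_cat // drop_size_cat //.
  by rewrite coef_basis // coef_ffun //; case: y.
rewrite size_cat in sw; split; first by rewrite size_cat /= -sw !addnS.
apply/ffunP=> t; rewrite !ffunE.
have [|s [y [z [s' [-> ss ss']]]]] := @tuple_split _ t (size w1); first by lia.
rewrite drop_pair // drop_size_cat // heart_coef_cup // /= take0 deltaE.
rewrite -[X in coef _ X]/(tval [tuple]) coef_tuple ffunE take_size_cat //= mulrC.
by rewrite coef_ffun // size_cat; lia.
Qed.

(** Some rule always applies: a nonempty word without descent either starts with -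
    or ends with +. *)
Lemma heart_ex n (w : seq bool) : size w = n -> exists x : tens F n, heart q w x.
Proof.
have [m] := ubnP n; elim: m n w => // m IH n w ltn sw.
have [Ew|[u [v Ew]]] := sorted_or_descent w.
  case: (count_mem _ w) Ew => [|a] Ew.
    case/lastP: w => [|w b] in Ew sw *.
      by case: n sw {ltn} => // _; eexists; apply: heart_nil.
    have -> : b = vp.
      have : b \in rcons w b by rewrite mem_rcons mem_head.
      by rewrite Ew mem_nseq => /andP[_ /eqP].
    case: n sw ltn => [|n]; rewrite size_rcons // => -[sw] ltn.
    have [x hx] := IH n w ltn sw; eexists; exact: heart_plus hx.
  case: w Ew sw => // b w [-> _]; case: n ltn => // n ltn [sw].
  have [x hx] := IH n w ltn sw; eexists; exact: heart_minus hx.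
rewrite Ew in sw *; move: sw ltn; rewrite size_cat /= !addnS -size_cat => <- ltn.
have [|x hx] := IH _ (u ++ v) _ erefl; first by lia.
by eexists; exact: heart_delta hx.
Qed.

Hypothesis q_neq0 : q != 0.

(** Applying epsilon at a pair -+ removes it. If the - is linked with an earlier +,
    this is the zigzag identity (id (x) epsilon) (delta (x) id) = id with the
    second factor of delta contracted; if it is free, the + takes its place at the
    bottom of the stack. *)
Lemma heart_coef_cap st u v s s' : size u = size s ->
  - q * heart_coef st (u ++ [:: vm, vp & v]) (s ++ [:: vp, vm & s'])
  + heart_coef st (u ++ [:: vm, vp & v]) (s ++ [:: vm, vp & s']) =
  heart_coef st (u ++ v) (s ++ s').
Proof.
elim: u s st => [|b u IH] [|z s] // st; last move=> [sz].
  move=> _; case: st => [|[] st] /=.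
  - by rewrite mul0r mulr0 add0r mul1r (heart_coef_bottom [::]).
  - by rewrite mul0r mulr0 add0r mul1r.
  - by rewrite mul0r addr0 mulrA mulrNN divff // mul1r.
case: b => /=; first exact: IH.
by case: st => [|z' st]; rewrite mulrCA -mulrDr IH.
Qed.

Lemma amplify_cap n u v : size (u ++ [:: vm, vp & v]) = n ->
  amplify n (size u) (delta q \o epsilon q) (heart_tens n (u ++ [:: vm, vp & v])) =
  heart_tens n (u ++ [:: vp, vm & v]).
Proof.
set w' := u ++ [:: vm, vp & v] => sz; apply/ffunP=> t; rewrite !ffunE.
have [|s [x [y [s' [-> ss ss']]]]] := @tuple_split _ t (size u).
  by rewrite -sz size_cat /=; lia.
rewrite drop_pair // drop_size_cat // take_size_cat // heart_coef_cup //.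
rewrite /= take0 deltaE epsilonE.
have E a b : coef [ffun r : 2.-tuple bool => coef (heart_tens n w') (s ++ r ++ s')] [:: a; b]
  = heart_coef [::] w' (s ++ [:: a, b & s']).
  rewrite (coef_ffun (fun r => coef (heart_tens n w') (s ++ r ++ s'))) //.
  by rewrite coef_ffun //= -ss' size_cat /= ss !addnS.
by rewrite !E heart_coef_cap // mulrC.
Qed.

(** * Comparing the two sides *)

Lemma tl_mul_diag n (D' D A : diagram n) :
  is_stack D' D A -> loops D' D = 0%N ->
  tl_mul q (tl_diag F D') (tl_diag F D) = tl_diag F A.
Proof.
move=> st nl; apply/ffunP=> B; rewrite !ffunE.
rewrite (bigD1 D') //= [X in _ + X]big1 ?addr0 => [|A' /negbTE nA]; last first.
  by apply: big1 => A'' _; rewrite ffunE nA !mul0r.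
have [->|nB] := eqVneq B A.
  rewrite (bigD1 D) //= big1 ?addr0 => [|A' /andP[_ /negbTE nA]].
    by rewrite !ffunE !eqxx nl expr0 !mulr1.
  by rewrite [tl_diag F D A']ffunE nA mulr0 mul0r.
apply: big1 => A' hA'; rewrite [tl_diag F D A']ffunE; case: eqP => [E|_].
  by case/eqP: nB; rewrite E in hA'; exact: is_stack_inj hA' st.
by rewrite mulr0 mul0r.
Qed.

(** By bubble sort: both sides start from the same basis vector on sorted words, and
    both are multiplied by e_i when a descent is created at i. *)
Lemma d_diagram_action n (rho : TL F n -> tens F n -> tens F n) (w : n.-tuple bool) :
  is_TL_action q rho ->
  rho (tl_diag F (d_diagram w))
    (basis F n (nseq (count_mem vm w) vm ++ nseq (n - count_mem vm w) vp)) =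
  heart_tens n w.
Proof.
move=> act; move Es : (tval w) => s.
have ss : size s = n by rewrite -Es size_tuple.
elim/word_ind: s ss w Es => [a b|u v IH] ss w Ew.
  rewrite (d_diagram_sorted Ew) (action1 act); apply/ffunP=> t.
  rewrite !ffunE heart_coef_sorted; congr (_ == _)%:R.
  rewrite -ss size_cat !size_nseq count_cat !count_nseq /= mul1n mul0n addn0.
  by rewrite addKn.
have ss' : size (u ++ [:: vm, vp & v]) == n by rewrite -ss !size_cat.
have hi : ((size u).+1 < n)%N by rewrite -ss size_cat /=; lia.
pose w' : n.-tuple bool := Tuple ss'.
have Ew' : w' = u ++ [:: vm, vp & v] :> seq bool by [].
rewrite (d_diagram_swap Ew Ew' hi); move: (swap_uncapped Ew Ew' hi) => h.
rewrite -(tl_mul_diag (cap_is_stack h) (cap_loops h)) (actionM act) (action_e act).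
have -> : count_mem vm (u ++ [:: vp, vm & v]) = count_mem vm (u ++ [:: vm, vp & v]).
  by rewrite !count_cat /= ; lia.
by rewrite (IH (eqP ss') w') // amplify_cap //; apply/eqP.
Qed.

End Hearts.

Local Open Scope complex_scope.

Theorem theorem8p3 (R : realType) (q : R[i]) (q_neq0 : q != 0)
    (q_not_root : forall m : nat, (0 < m)%N -> q ^+ m != 1)
    (n : nat) (rho : TL R[i] n -> tens R[i] n -> tens R[i] n)
    (rho_action : is_TL_action q rho) (w : n.-tuple bool) :
  let k := count_mem vm w in
  forall x : tens R[i] n,
    heart q w x <->
    x = rho (tl_diag R[i] (d_diagram w))
          (basis R[i] n (nseq k vm ++ nseq (n - k) vp)).
Proof.
move=> k x; rewrite /k (d_diagram_action q_neq0 w rho_action).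
split=> [/heartP[]//|->].
by have [y hy] := heart_ex q (size_tuple w); have [_ <-] := heartP hy.
Qed.
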